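(* Let $P(\lambda)=A_0+\lambda A_1+\cdots+\lambda^dA_d$ be an $n\times n$ singular matrix polynomial of degree $d$ and normal rank $n-k$, with right minimal indices $\varepsilon_1\le\cdots\le\varepsilon_k$ and left minimal indices $\eta_1\le\cdots\le\eta_k$, such that all its eigenvalues are semisimple, and let $M=\varepsilon_1+\cdots+\varepsilon_k$, $N=\eta_1+\cdots+\eta_k$. Let $B_0,\dots,B_d\in\mathbb C^{k\times k}$ be such that $Q(\lambda):=B_0+\lambda B_1+\cdots+\lambda^dB_d$ is regular and its eigenvalues are simple and distinct from the eigenvalues of $P(\lambda)$. Then there exists a generic set $\Omega\subseteq\mathbb C^{n\times k}\times\mathbb C^{k\times n}$ such that for all $(U,V^* )\in\Omega$ and all $\tau>0$ the matrix polynomial $$\widetilde P(\lambda)=P(\lambda)+\tau\,U\,Q(\lambda)\,V^*$$ is regular and its $nd$ eigenvalues (counted with algebraic multiplicity, including infinite ones) are independent of $\tau$ and can be classified into the following four groups: (a) (True eigenvalues) If $\lambda_0$ is an eigenvalue of $P(\lambda)$, then $\lambda_0$ is also an eigenvalue of $\widetilde P(\lambda)$. If $x$ and $y$ are corresponding right and left eigenvectors then $V^*x=0$ and $U^*y=0$. There are $(n-k)d-M-N$ such eigenvalues. (b) (Right random eigenvalues) There are $M$ simple eigenvalues, all different from the eigenvalues in (a) and from those of $Q(\lambda)$, such that $V^*x=0$ and $U^*y\neq0$, where $x$ and $y$ are corresponding right and left eigenvectors. (c) (Left random eigenvalues) There are $N$ simple eigenvalues, all different from the eigenvalues in (a) and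 (b) and from those of $Q(\lambda)$, such that $V^*x\neq0$ and $U^*y=0$, where $x$ and $y$ are corresponding right and left eigenvectors. (d) (Prescribed eigenvalues) If $\lambda_0$ is an eigenvalue of $Q(\lambda)$, then $\lambda_0$ is also an eigenvalue of $\widetilde P(\lambda)$. If $x$ and $y$ are corresponding right and left eigenvectors, then $V^*x\neq0$ and $U^*y\neq0$. There are $kd$ such eigenvalues.
   Context: Normal rank: $\mathrm{nrank}(P)=\max_{\zeta\in\mathbb C}\mathrm{rank}\,P(\zeta)$; an $n\times n$ matrix polynomial is singular if $\det P\equiv0$ and regular otherwise. A finite eigenvalue of $P$ is $\lambda_0\in\mathbb C$ with $\mathrm{rank}\,P(\lambda_0)<\mathrm{nrank}(P)$. By the Smith form, there are unimodular $E(\lambda),F(\lambda)$ with $E(\lambda)P(\lambda)F(\lambda)=\mathrm{diag}(d_1(\lambda),\dots,d_r(\lambda),0,\dots,0)$, $d_i$ monic, $d_i\mid d_{i+1}$, $r=\mathrm{nrank}(P)$. Writing $d_i(\lambda)=(\lambda-\lambda_0)^{\alpha_i}p_i(\lambda)$ with $p_i(\lambda_0)\neq0$, the algebraic multiplicity of $\lambda_0$ is $\sum\alpha_i$ and the geometric multiplicity is the number of nonzero $\alpha_i$; an eigenvalue is semisimple if these coincide and simple if the algebraic multiplicity is 1. The reversal is $\mathrm{rev}\,P(\lambda)=\lambda^dP(1/\lambda)$; $\infty$ is an eigenvalue of $P$ (with multiplicities) if $0$ is an eigenvalue of $\mathrm{rev}\,P$. Right/left nullspaces: rational vectors $x(\lambda)$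 with $P(\lambda)x(\lambda)\equiv0$, resp. $y(\lambda)$ with $y(\lambda)^*P(\lambda)\equiv0$; the right/left minimal indices are the degrees of the vectors of a polynomial basis of the right/left nullspace having minimal total degree. For a regular $\widetilde P$, right/left eigenvectors for $\lambda_0$ are nonzero $x,y$ with $\widetilde P(\lambda_0)x=0$, $y^*\widetilde P(\lambda_0)=0$. A set in $\mathbb C^N$ (matrix spaces identified with $\mathbb C^N$) is generic if its complement is contained in a proper algebraic subset. *)

(* Defs.v *)
From HB Require Import structures.
From mathcomp Require Import all_boot all_order all_algebra.
From mathcomp Require Import fraction.
From mathcomp Require Import reals.
From mathcomp.real_closed Require Import complex.
From mathcomp Require Import mpoly.
Set Implicit Arguments. Unset Strict Implicit. Unset Printing Implicit Defensive.
Import GRing.Theory Num.Theory.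
Local Open Scope ring_scope.

Section MatrixPolynomials.
Variable R : realType.
Local Notation C := (R[i]).

Definition mxpol (d m n : nat) (A : nat -> 'M[C]_(m, n)) : 'M[{poly C}]_(m, n) :=
  \matrix_(i, j) \poly_(l < d.+1) (A l i j).

(* coefficients of the reversal rev P(l) = l^d P(1/l) *)
Definition mxrev (d m n : nat) (A : nat -> 'M[C]_(m, n)) : nat -> 'M[C]_(m, n) :=
  fun l => A (d - l)%N.

Definition mxeval m n (P : 'M[{poly C}]_(m, n)) (z : C) : 'M[C]_(m, n) :=
  map_mx (fun p => p.[z]) P.

Definition is_nrank m n (P : 'M[{poly C}]_(m, n)) (r : nat) :=
  (exists z, \rank (mxeval P z) = r) /\ (forall z, (\rank (mxeval P z) <= r)%N).

Definition singular n (P : 'M[{poly C}]_n) := \det P = 0.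
Definition regular n (P : 'M[{poly C}]_n) := \det P != 0.

Definition fin_eigenvalue n (P : 'M[{poly C}]_n) (z : C) :=
  exists r, is_nrank P r /\ (\rank (mxeval P z) < r)%N.

Definition unimodular n (E : 'M[{poly C}]_n) := exists c : C, c != 0 /\ \det E = c%:P.

Definition smith_form n (P : 'M[{poly C}]_n) (r : nat) (dd : nat -> {poly C}) :=
  is_nrank P r /\
  (exists E F : 'M[{poly C}]_n, unimodular E /\ unimodular F /\
     E *m P *m F = \matrix_(i, j) (if (i == j) && (i < r)%N then dd i else 0)) /\
  (forall i, (i < r)%N -> dd i \is monic) /\
  (forall i, (i.+1 < r)%N -> dvdp (dd i) (dd i.+1)).

Definition fin_alg_mult n (P : 'M[{poly C}]_n) (z : C) (m : nat) :=
  exists r dd, smith_form P r dd /\ m = (\sum_(i < r) mup z (dd i))%N.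

(* semisimple: algebraic multiplicity = geometric multiplicity (number of nonzero alpha_i) *)
Definition fin_semisimple n (P : 'M[{poly C}]_n) (z : C) :=
  exists r dd, smith_form P r dd /\
    (\sum_(i < r) mup z (dd i))%N = #|[set i : 'I_r | (0 < mup z (dd i))%N]|.

(* Extended eigenvalues: Some z is the finite point z, None is infinity, which is
   handled through the reversal (of grade d) at 0. *)
Definition ext_mxpol d n (A : nat -> 'M[C]_n) (z : option C) : 'M[{poly C}]_n :=
  if z is Some _ then mxpol d A else mxpol d (mxrev d A).
Definition ext_pt (z : option C) : C := if z is Some l then l else 0.

Definition peigenvalue d n (A : nat -> 'M[C]_n) (z : option C) :=
  fin_eigenvalue (ext_mxpol d A z) (ext_pt z).
Definition alg_mult d n (A : nat -> 'M[C]_n) (z : option C) (m : nat) :=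
  fin_alg_mult (ext_mxpol d A z) (ext_pt z) m.
Definition semisimple_eig d n (A : nat -> 'M[C]_n) (z : option C) :=
  fin_semisimple (ext_mxpol d A z) (ext_pt z).

Definition ctr m n (M : 'M[C]_(m, n)) : 'M[C]_(n, m) := (map_mx (@conjc R) M)^T.

(* right / left eigenvectors (for a regular matrix polynomial) *)
Definition right_eigvec d n (A : nat -> 'M[C]_n) (z : option C) (x : 'cV[C]_n) :=
  x != 0 /\ mxeval (ext_mxpol d A z) (ext_pt z) *m x = 0.
Definition left_eigvec d n (A : nat -> 'M[C]_n) (z : option C) (y : 'cV[C]_n) :=
  y != 0 /\ ctr y *m mxeval (ext_mxpol d A z) (ext_pt z) = 0.

Definition tofrac_mx m n (X : 'M[{poly C}]_(m, n)) : 'M[{fraction {poly C}}]_(m, n) :=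
  map_mx (@FracField.tofrac _) X.

Definition right_poly_basis n (P : 'M[{poly C}]_n) k (X : 'M[{poly C}]_(n, k)) :=
  P *m X = 0 /\ row_free (tofrac_mx X)^T /\
  (forall x : 'cV[{fraction {poly C}}]_n,
      tofrac_mx P *m x = 0 -> exists c : 'cV_k, x = tofrac_mx X *m c).

Definition vdeg n k (X : 'M[{poly C}]_(n, k)) (j : 'I_k) : nat :=
  (\max_(i < n) size (X i j)).-1.

Definition right_minimal_basis n (P : 'M[{poly C}]_n) k (X : 'M[{poly C}]_(n, k)) :=
  right_poly_basis P X /\
  (forall X' : 'M[{poly C}]_(n, k), right_poly_basis P X' ->
     (\sum_j vdeg X j <= \sum_j vdeg X' j)%N).

Definition right_minimal_indices n (P : 'M[{poly C}]_n) k (eps : 'I_k -> nat) :=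
  exists X : 'M[{poly C}]_(n, k), right_minimal_basis P X /\ forall j, vdeg X j = eps j.

(* left nullspace: rational y with y^T P = 0, i.e. right nullspace of P^T *)
Definition left_minimal_indices n (P : 'M[{poly C}]_n) k (eta : 'I_k -> nat) :=
  right_minimal_indices P^T eta.

Definition coords n k (U : 'M[C]_(n, k)) (W : 'M[C]_(k, n)) : 'I_(n * k + k * n) -> C :=
  fun i => row_mx (mxvec U) (mxvec W) 0 i.

(* complement contained in the proper algebraic set Z(S) (common zeros of S) *)
Definition generic_set n k (Om : 'M[C]_(n, k) -> 'M[C]_(k, n) -> Prop) :=
  exists S : {mpoly C[n * k + k * n]} -> Prop,
    (exists (v : 'I_(n * k + k * n) -> C) (p : {mpoly C[n * k + k * n]}),
        S p /\ p.@[v] != 0) /\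
    (forall U W, ~ Om U W -> forall p, S p -> p.@[coords U W] = 0).

End MatrixPolynomials.

(* Main.v *)
Require Import Defs.
From HB Require Import structures.
From mathcomp Require Import all_boot all_order all_algebra.
From mathcomp Require Import fraction reals.
From mathcomp.real_closed Require Import complex.
From mathcomp Require Import mpoly.
From mathcomp Require Import perm boolp zify.
Set Implicit Arguments. Unset Strict Implicit. Unset Printing Implicit Defensive.
Import GRing.Theory Num.Theory.
Local Open Scope ring_scope.

(** The Smith form provides unimodular [E = col (E1, Y)] and [F = row (F1, X)]
with [E P F = diag (D, 0)], [D] of size [n - k].  Multiplying [P + U Z W] by
[E] and [F] and factoring gives
  [det (P + U Z W) = c g det (Y U) (det Z) det (W X)]  with  [g = det D].
Minimality of a null space basis means that it differs from [X] by a unimodular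
factor and that its leading coefficients are independent; hence [X], [Y^T] may
be taken to be the given minimal bases, and [det (W X)], [det (Y U)] have
degrees [M] and [N] for generic [U], [W].  The roots of [g], [det (W X)],
[det (Y U)] and [det Q] are the four groups of finite eigenvalues; infinity is
treated by the same factorisation for the reversals, and comparing degrees
gives the number of true eigenvalues.  Generically [det (W X) det (Y U)] is
squarefree: it is affine in each entry of [(U, W)], its values at any given
point do not all vanish, and a pencil [p + t q] acquires a double root for only
finitely many [t] unless it has a fixed one. *)

(** * Smith normal form over a polynomial ring *)

(** The points where [det (W X)] and [det (Y U)] could repeat or share a root move with [(U, W)].
    Square-freeness is therefore not a finite conjunction of conditions at fixed points, unlike the
    avoidance of the eigenvalues of P and Q. It is imposed as the nonvanishing of a leading
    coefficient times (in positive degree) a resultant, a polynomial in the entries of [(U, W)]; the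
    real work is to find a single pair at which this polynomial does not vanish. Infinity is one of
    the fixed points to avoid, so all random eigenvalues are finite and the degrees M and N count
    them exactly. Hence bases of controlled degree are needed only for P itself: any splitting of
    the reversal will do, since only its behaviour at 0 matters. *)

Definition mxequivalent (F : fieldType) m n (A B : 'M[{poly F}]_(m, n)) :=
  exists L R, [/\ L \in unitmx, R \in unitmx & L *m A *m R = B].

Lemma mxequivalent_refl (F : fieldType) m n (A : 'M[{poly F}]_(m, n)) :
  mxequivalent A A.
Proof. by exists 1%:M, 1%:M; rewrite !unitmx1 mulmx1 mul1mx. Qed.

Lemma mxequivalent_trans (F : fieldType) m n (A B D : 'M[{poly F}]_(m, n)) :
  mxequivalent A B -> mxequivalent B D -> mxequivalent A D.
Proof.
move=> [L [R [uL uR <-]]] [L' [R' [uL' uR' <-]]].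
by exists (L' *m L), (R *m R'); rewrite !unitmx_mul uL uR uL' uR' !mulmxA.
Qed.

Lemma mxequivalent_mull (F : fieldType) m n L (A : 'M[{poly F}]_(m, n)) :
  L \in unitmx -> mxequivalent A (L *m A).
Proof. by move=> uL; exists L, 1%:M; rewrite uL unitmx1 mulmx1. Qed.

Lemma mxequivalent_mulr (F : fieldType) m n R (A : 'M[{poly F}]_(m, n)) :
  R \in unitmx -> mxequivalent A (A *m R).
Proof. by move=> uR; exists 1%:M, R; rewrite uR unitmx1 mul1mx. Qed.

Lemma mxequivalent_tr (F : fieldType) m n (A : 'M[{poly F}]_(m, n)) B :
  mxequivalent A^T B -> mxequivalent A B^T.
Proof.
move=> [L [R [uL uR <-]]]; exists R^T, L^T; rewrite !unitmx_tr uL uR.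
by rewrite !trmx_mul trmxK mulmxA.
Qed.

Definition transvection (T : comNzRingType) n (i j : 'I_n) (c : T) : 'M[T]_n :=
  1%:M + c *: delta_mx i j.

Lemma transvection_unit (T : comUnitRingType) n (i j : 'I_n) (c : T) :
  i != j -> transvection i j c \in unitmx.
Proof.
move=> nij; suff /mulmx1_unit[] : transvection i j c *m transvection i j (- c) = 1%:M by [].
rewrite /transvection mulmxDl !mulmxDr !mul1mx mulmx1 -!scalemxAl -!scalemxAr.
rewrite mul_delta_mx_cond eq_sym (negbTE nij) mulr0n !scaler0 addr0 scaleNr.
by rewrite -addrA addNr addr0.
Qed.

Lemma mul_transvectionE (T : comNzRingType) m n (p q : 'I_m) (c : T)
    (A : 'M[T]_(m, n)) i j :
  (transvection p q c *m A) i j = A i j + (if i == p then c * A q j else 0).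
Proof.
rewrite /transvection mulmxDl mul1mx mxE; congr (_ + _).
rewrite -scalemxAl !mxE (bigD1 q) //= big1 ?addr0 => [|l nl].
  by rewrite !mxE eqxx andbT; case: eqP => _; rewrite ?mul1r ?mul0r ?mulr0.
by rewrite !mxE (negbTE nl) andbF mul0r.
Qed.

Lemma xcolrow_equiv (F : fieldType) m n (A : 'M[{poly F}]_(m, n)) i i' j j' :
  mxequivalent A (xrow i i' (xcol j j' A)).
Proof.
apply: (@mxequivalent_trans _ _ _ _ (xcol j j' A)).
  by rewrite xcolE; apply: mxequivalent_mulr; rewrite unitmx_perm.
by rewrite xrowE; apply: mxequivalent_mull; rewrite unitmx_perm.
Qed.

(** Induction on a bound for the size of some nonzero entry, moved to the corner. If it fails to
    divide an entry of its row or column, the remainder is a nonzero entry of smaller degree; an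
    offending entry elsewhere is first brought into the row of the pivot. *)
Lemma smith_pivot (F : fieldType) s m n (A : 'M[{poly F}]_(m.+1, n.+1)) i j :
  A i j != 0 -> (size (A i j) <= s)%N ->
  exists B, [/\ mxequivalent A B, B 0 0 != 0 & forall i j, B 0 0 %| B i j].
Proof.
elim: s m n A i j => [|s IH] m n A i j nz szA.
  by move: nz; rewrite -size_poly_eq0 -leqn0 szA.
have rowcase m' n' (B : 'M[{poly F}]_(m'.+1, n'.+1)) l : B 0 0 != 0 ->
    (size (B 0%R 0%R) <= s.+1)%N -> ~~ (B 0 0 %| B 0 l) ->
    exists D, [/\ mxequivalent B D, D 0 0 != 0 & forall i j, D 0 0 %| D i j].
  move=> nzB szB ndv.
  have nl : 0 != l by apply: contraNneq ndv => <-.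
  pose B' := (transvection l 0 (- (B 0 l %/ B 0 0)) *m B^T)^T.
  have EB' : B' 0 l = B 0 l %% B 0 0.
    rewrite /B' mxE mul_transvectionE eqxx !mxE mulNr.
    by apply/eqP; rewrite subr_eq addrC -divp_eq.
  have eB' : mxequivalent B B'.
    by apply/mxequivalent_tr/mxequivalent_mull/transvection_unit; rewrite eq_sym.
  have [||D [eD nzD dvD]] := IH _ _ B' 0 l.
  - by rewrite EB'.
  - by rewrite EB' -ltnS (leq_trans _ szB) // ltn_modp.
  by exists D; split => //; apply: mxequivalent_trans eD.
have colcase m' n' (B : 'M[{poly F}]_(m'.+1, n'.+1)) l : B 0 0 != 0 ->
    (size (B 0%R 0%R) <= s.+1)%N -> ~~ (B 0 0 %| B l 0) ->
    exists D, [/\ mxequivalent B D, D 0 0 != 0 & forall i j, D 0 0 %| D i j].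
  move=> nzB szB ndv; have [|||D [eD nzD dvD]] := @rowcase _ _ B^T l; rewrite ?mxE //.
  exists D^T; split; [exact: mxequivalent_tr | by rewrite mxE|].
  by move=> a b; rewrite !mxE.
pose A1 := xrow i 0 (xcol j 0 A).
have eA1 : mxequivalent A A1 by apply: xcolrow_equiv.
have E00 : A1 0 0 = A i j by rewrite !mxE !tpermR.
suff [B [eB nzB dvB]] : exists B,
    [/\ mxequivalent A1 B, B 0 0 != 0 & forall i j, B 0 0 %| B i j].
  by exists B; split => //; apply: mxequivalent_trans eB.
rewrite -E00 in nz szA.
have [dvrow|/existsNP[l /negP]] := pselect (forall l, A1 0 0 %| A1 0 l); last exact: rowcase.
have [dvcol|/existsNP[l /negP]] := pselect (forall l, A1 0 0 %| A1 l 0); last exact: colcase.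
have [dvA|/existsNP[p /existsNP[q /negP ndv]]] := pselect (forall p q, A1 0 0 %| A1 p q).
  by exists A1; split => //; apply: mxequivalent_refl.
have np : p != 0 by apply: contraNneq ndv => ->.
(* Subtracting [t] times row 0 clears the first entry of row [p]; adding the result to row 0 then
   keeps the pivot and creates in its row an entry it does not divide. *)
pose t := A1 p 0 %/ A1 0 0.
pose A2 := transvection p 0 (- t) *m A1.
pose A3 := transvection 0 p 1 *m A2.
have eA3 : mxequivalent A1 A3.
  apply: (@mxequivalent_trans _ _ _ _ A2); apply/mxequivalent_mull/transvection_unit => //.
  by rewrite eq_sym.
have A30 l : A3 0 l = A1 0 l + (A1 p l - t * A1 0 l).
  by rewrite !mul_transvectionE !eqxx eq_sym (negbTE np) addr0 mul1r mulNr.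
have A300 : A3 0 0 = A1 0 0 by rewrite A30 divpK ?subrr ?addr0.
have [|||B [eB nzB dvB]] := @rowcase _ _ A3 q; rewrite ?A300 ?A30 //; last first.
  by exists B; split => //; apply: mxequivalent_trans eB.
by rewrite dvdp_addr ?dvrow // dvdp_subl ?dvdp_mull ?dvrow.
Qed.

Lemma dvdp_mulmx (F : fieldType) m n p q (g : {poly F}) (A : 'M_(m, n))
    (L : 'M_(p, m)) (R : 'M_(n, q)) :
  (forall i j, g %| A i j) -> forall i j, g %| (L *m A *m R) i j.
Proof.
move=> dv i j; rewrite mxE.
elim/big_ind: _ => [|x y|l _]; [exact: dvdp0|exact: dvdp_add|apply: dvdp_mulr].
rewrite mxE; elim/big_ind: _ => [|x y|l' _]; [exact: dvdp0|exact: dvdp_add|exact: dvdp_mull].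
Qed.

(** Once the pivot has cleared its row and column, it divides every entry of the remaining block,
    hence of every matrix equivalent to that block. Padding the diagonal with zeros over all of
    [nat] keeps the divisibility chain, as everything divides 0. *)
Theorem poly_smith_normal_form (F : fieldType) m n (A : 'M[{poly F}]_(m, n)) :
  exists d : nat -> {poly F},
    [/\ forall i, d i %| d i.+1, forall i, (minn m n <= i)%N -> d i = 0
      & mxequivalent A (\matrix_(i, j) (if i == j :> nat then d i else 0))].
Proof.
elim: m n A => [|m IH] n A.
  exists (fun=> 0); split=> //; exists 1%:M, 1%:M; rewrite !unitmx1; split=> //.
  by apply/matrixP => [[]].
have [nz|/forallNP z] := pselect (exists i, exists j, A i j != 0); last first.
  exists (fun=> 0); split=> //; exists 1%:M, 1%:M; rewrite !unitmx1; split=> //.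
  apply/matrixP => i j; rewrite mulmx1 mul1mx mxE if_same.
  by apply/eqP; apply/negPn/negP => nz; apply: (z i); exists j.
case: nz => i [j nz]; case: n => [|n] in A j nz *; first by case: j nz => [[]].
have [B [eAB nzB dvB]] := smith_pivot nz (leqnn _).
set a := B 0 0 in nzB dvB.
pose u : 'rV_n := \row_l (B 0 (lift 0 l) %/ a).
pose v : 'cV_m := \col_l (B (lift 0 l) 0 %/ a).
pose B' : 'M_(1 + m, 1 + n) := B.
pose L : 'M_(1 + m) := block_mx 1 0 (- v) 1%:M.
pose R : 'M_(1 + n) := block_mx 1 (- u) 0 1%:M.
have Eul : ulsubmx B' = a%:M.
  by apply/matrixP => p q; rewrite !ord1 !mxE eqxx /B' !lshift0.
have Eur : ursubmx B' = a *: u.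
  by apply/matrixP => p q; rewrite ord1 !mxE mulrC divpK ?dvB // /B' lshift0 rshift1.
have Edl : dlsubmx B' = a *: v.
  by apply/matrixP => p q; rewrite ord1 !mxE mulrC divpK ?dvB // /B' lshift0 rshift1.
pose M := drsubmx B' - a *: (v *m u).
have EB : L *m B' *m R = block_mx a%:M 0 0 M.
  rewrite -[B']submxK Eul Eur Edl /L /R !mulmx_block.
  rewrite !mul1mx !mul0mx !mulmx1 !mulmx0 !addr0.
  rewrite !mulNmx !mul_mx_scalar addNr mul0mx add0r mulmxN mul_scalar_mx addNr.
  by rewrite addrC /M scalemxAr.
have dvM i' j' : a %| M i' j'.
  by rewrite !mxE dvdp_sub ?dvdp_mulr // dvB.
have [d [dvd d0 [L' [R' [uL' uR' ED]]]]] := IH _ M.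
exists (fun l => if l is l'.+1 then d l' else a); split.
- case=> [|l]; last exact: dvd.
  have [lt|/d0->] := ltnP 0 (minn m n); last exact: dvdp0.
  rewrite ltnNge geq_min negb_or -!ltnNge in lt; case/andP: lt => lm ln.
  have /(congr1 (fun X : 'M__ => X (Ordinal lm) (Ordinal ln))) := ED.
  by rewrite [in RHS]mxE eqxx => <-; apply: dvdp_mulmx.
- by case=> [|l]; rewrite minnSS // ltnS => /d0.
apply: (mxequivalent_trans eAB).
have uL : L \in unitmx by rewrite unitmxE det_lblock !det1 mulr1 unitr1.
have uR : R \in unitmx by rewrite unitmxE det_ublock !det1 mulr1 unitr1.
apply: (@mxequivalent_trans _ _ _ _ (block_mx a%:M 0 0 M : 'M_(1 + m, 1 + n))).
  by exists L, R; rewrite uL uR EB.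
exists (block_mx 1 0 0 L' : 'M_(1 + m)), (block_mx 1 0 0 R' : 'M_(1 + n)).
rewrite !unitmxE !det_lblock det1 !mul1r -!unitmxE; split=> //.
rewrite !mulmx_block !mul1mx !mul0mx !mulmx1 !mulmx0 !addr0 !add0r !mul0mx ED.
apply/matrixP => p q; rewrite [RHS]mxE.
case: (split_ordP p) => p' ->; case: (split_ordP q) => q' ->.
- by rewrite block_mxEul !ord1 mxE eqxx.
- by rewrite block_mxEur !ord1 mxE.
- by rewrite block_mxEdl !ord1 mxE.
by rewrite block_mxEdr mxE /= !add1n eqSS.
Qed.

(** * Evaluation, rank and algebraic multiplicity of complex matrix polynomials *)

Lemma poly_nonroot (C : numDomainType) (p : {poly C}) : p != 0 -> exists z, p.[z] != 0.
Proof.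
move=> nzp; apply: contrapT => /forallNP h.
pose rs := [seq i%:R : C | i <- iota 0 (size p)].
have urs : uniq rs by rewrite map_inj_uniq ?iota_uniq // => i j /eqP; rewrite eqr_nat => /eqP.
suff /(max_poly_roots nzp)/(_ urs) : all (root p) rs by rewrite size_map size_iota ltnn.
by apply/allP => z _; rewrite /root; apply/negPn/negP => /h.
Qed.

Lemma unitmx_poly_det (F : fieldType) n (E : 'M[{poly F}]_n) :
  E \in unitmx <-> exists c : F, c != 0 /\ \det E = c%:P.
Proof.
rewrite unitmxE poly_unitE; split=> [/andP[/size_poly1P[c nzc ->] _]|[c [nzc ->]]].
  by exists c.
by rewrite size_polyC nzc coefC unitfE.
Qed.

Lemma rank_diag_le (F : fieldType) n (f : nat -> F) s : (s <= n)%N ->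
  (forall i, (s <= i)%N -> f i = 0) ->
  (\rank (\matrix_(i < n, j < n) (if i == j :> nat then f i else 0%R)) <= s)%N.
Proof.
move=> sn f0; set D := \matrix_(i, j) _.
have -> : D = pid_mx s *m D.
  apply/matrixP => i j; rewrite mxE [RHS]mxE (bigD1 i) //= big1 => [|l nl].
    rewrite !mxE eqxx addr0 /=; case: ltnP => [|/f0 ->]; rewrite ?mul1r ?mul0r //.
    by rewrite if_same.
  by rewrite !mxE eq_sym (negbTE (nl : val l != val i)) mul0r.
by apply: leq_trans (mxrankM_maxl _ _) _; rewrite rank_pid_mx.
Qed.

Lemma rank_diag_eq (F : fieldType) n (f : nat -> F) s : (s <= n)%N ->
  (forall i, (f i == 0) = (s <= i)%N) ->
  \rank (\matrix_(i < n, j < n) (if i == j :> nat then f i else 0)) = s.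
Proof.
move=> sn f0; set D := \matrix_(i, j) _.
apply/eqP; rewrite eqn_leq rank_diag_le //=; last by move=> i; rewrite -f0 => /eqP.
(* The diagonal of inverses turns [D] into [pid_mx s], which gives the lower bound. *)
have {1}-> : s = \rank ((\matrix_(i < n, j < n) (if i == j :> nat then (f i)^-1 else 0)) *m D).
  rewrite -[LHS](rank_pid_mx F sn sn); congr (\rank _).
  apply/matrixP => i j; rewrite mxE [RHS]mxE (bigD1 i) //= big1 => [|l nl].
    rewrite !mxE eqxx addr0 /=; case: eqP => _ /=; last by rewrite mulr0.
    have := f0 i; case: leqP => _ fi; last by rewrite mulVf ?fi.
    by rewrite (eqP fi) mulr0.
  by rewrite !mxE eq_sym (negbTE (nl : val l != val i)) mul0r.
exact: mxrankM_maxr.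
Qed.

Lemma mxevalM (R : realType) m n p (A : 'M[{poly R[i]}]_(m, n)) (B : 'M_(n, p)) z :
  mxeval (A *m B) z = mxeval A z *m mxeval B z.
Proof. exact: (map_mxM (horner_eval z)). Qed.

Lemma mxevalD (R : realType) m n (A B : 'M[{poly R[i]}]_(m, n)) z :
  mxeval (A + B) z = mxeval A z + mxeval B z.
Proof. exact: (map_mxD (horner_eval z)). Qed.

Lemma mxeval_det (R : realType) n (A : 'M[{poly R[i]}]_n) z :
  \det (mxeval A z) = (\det A).[z].
Proof. exact: (det_map_mx (horner_eval z)). Qed.

Lemma mxeval_unit (R : realType) n (A : 'M[{poly R[i]}]_n) z :
  A \in unitmx -> mxeval A z \in unitmx.
Proof.
by rewrite !unitmxE mxeval_det => /(rmorph_unit (horner_eval z)).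
Qed.

Lemma is_nrank_uniq (R : realType) m n (P : 'M[{poly R[i]}]_(m, n)) r r' :
  is_nrank P r -> is_nrank P r' -> r = r'.
Proof.
move=> [[z <-] le] [[z' <-] le']; apply/eqP.
by rewrite eqn_leq le le'.
Qed.

(** Unimodular factors preserve the rank at every point, so the number [s] of nonzero invariant
    factors is the maximal rank, attained wherever their product does not vanish. *)
Lemma smith_form_exists (R : realType) n (P : 'M[{poly R[i]}]_n) r :
  is_nrank P r -> exists dd, smith_form P r dd.
Proof.
move=> nrP; have [d [dvd d0 [L [Q [uL uQ ED]]]]] := poly_smith_normal_form P.
rewrite minnn in d0.
have ex0 : exists i, d i == 0 by exists n; rewrite d0.
case: (ex_minnP ex0) => s /eqP ds mins.
have sn : (s <= n)%N by apply: mins; rewrite d0.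
have dge i : (s <= i)%N -> d i = 0.
  move/subnKC <-; elim: (i - s)%N => [|l IH]; first by rewrite addn0.
  by have := dvd (s + l)%N; rewrite IH dvd0p addnS => /eqP.
have dlt i : (i < s)%N -> d i != 0 by move=> lt; apply/negP => /mins; rewrite leqNgt lt.
have rkD z : \rank (mxeval P z) =
    \rank (\matrix_(i < n, j < n) (if i == j :> nat then (d i).[z] else 0)).
  have -> : \matrix_(i < n, j < n) (if i == j :> nat then (d i).[z] else 0)
      = mxeval L z *m mxeval P z *m mxeval Q z.
    rewrite -!mxevalM ED; apply/matrixP => i j; rewrite !mxE.
    by case: eqP; rewrite ?horner0.
  by rewrite mxrankMfree ?row_free_unit ?mxeval_unit // eqmxMfull // row_full_unit mxeval_unit.
have rs : r = s.
  apply: is_nrank_uniq nrP _; split; last first.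
    by move=> z; rewrite rkD (rank_diag_le (f := fun i => (d i).[z])) // => i /dge ->; rewrite horner0.
  have [z] : exists z, (\prod_(i < s) d i).[z] != 0.
    by apply/poly_nonroot/prodf_neq0 => i _; apply: dlt.
  rewrite horner_prod => /prodf_neq0 nz; exists z.
  rewrite rkD (rank_diag_eq (f := fun i => (d i).[z]) (s := s)) // => i.
  case: leqP => [/dge ->|lt]; first by rewrite horner0 eqxx.
  by apply/negbTE/(nz (Ordinal lt)).
(* Dividing by [c] makes the invariant factors monic; the value 1 past [s] keeps the scaling matrix
   unimodular. *)
rewrite {r}rs in nrP *; pose c i := if (i < s)%N then lead_coef (d i) else 1.
have nzc i : c i != 0.
  by rewrite /c; case: ifP => [/dlt|_]; rewrite ?oner_eq0 // lead_coef_eq0.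
exists (fun i => (c i)^-1 *: d i); split=> //; split.
  pose S : 'M[{poly R[i]}]_n := diag_mx (\row_i ((c i)^-1)%:P).
  exists (S *m L), Q; split; [|split].
  - apply/unitmx_poly_det; rewrite unitmx_mul uL andbT unitmxE det_diag.
    apply: rpred_prod => i _; rewrite mxE poly_unitE size_polyC invr_eq0 nzc /=.
    by rewrite coefC eqxx unitfE invr_eq0 nzc.
  - exact/unitmx_poly_det.
  rewrite -2!mulmxA [L *m _]mulmxA ED; apply/matrixP => i j.
  rewrite mul_diag_mx !mxE (_ : (i == j :> nat) = (i == j)) //; case: eqP => _ /=; last by rewrite mulr0.
  by rewrite mul_polyC; case: ltnP => // /dge ->; rewrite scaler0.
split=> i lt.
  rewrite monicE lead_coefZ /c lt mulVf // lead_coef_eq0; exact: dlt.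
by rewrite dvdpZl ?dvdpZr ?invr_eq0.
Qed.

Lemma is_nrank_regular (R : realType) n (P : 'M[{poly R[i]}]_n) :
  \det P != 0 -> is_nrank P n.
Proof.
move=> /poly_nonroot[z nz]; split; last by move=> ?; apply: rank_leq_row.
by exists z; rewrite mxrank_unit // unitmxE mxeval_det unitfE.
Qed.

(** Unimodular factors contribute only nonzero constants, so the determinant is, up to a constant,
    the product of the invariant factors, and root multiplicities add up. *)
Lemma fin_alg_mult_regular (R : realType) n (P : 'M[{poly R[i]}]_n) z :
  \det P != 0 -> fin_alg_mult P z (mup z (\det P)).
Proof.
move=> nzP; have [dd sm] := smith_form_exists (is_nrank_regular nzP).
exists n, dd; split => //.
case: sm => _ [[E [F [[e [nze De]] [[f [nzf Df]] /(congr1 determinant) ED]]]] [mon _]].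
move: ED; rewrite !det_mulmx De Df.
have -> : \matrix_(i, j) (if (i == j) && (i < n)%N then dd i else 0) = diag_mx (\row_(i < n) dd i).
  by apply/matrixP => i j; rewrite !mxE ltn_ord andbT; case: eqP => [->|_]; rewrite ?mulr1n ?mulr0n.
rewrite det_diag => ED.
have nzd i : (i < n)%N -> dd i != 0 by move=> /mon /monic_neq0.
have nz : \prod_(i < n) dd i != 0 by apply/prodf_neq0 => i _; apply: nzd.
have -> : mup z (\det P) = mup z (\prod_(i < n) dd i).
  transitivity (mup z (e%:P * \det P * f%:P)).
    by rewrite mupMl ?rootC // mupMr ?rootC.
  by rewrite ED; congr mup; apply: eq_bigr => i _; rewrite mxE.
elim: (n) nzd {mon ED De Df nz} => [|l IH] nzd; first by rewrite !big_ord0 mupNroot ?rootC ?oner_eq0.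
rewrite !big_ord_recr mupM /= ?IH ?nzd //; last by apply/prodf_neq0 => i _; apply: nzd; rewrite ltnS ltnW.
by move=> i lt; apply: nzd; rewrite ltnS ltnW.
Qed.

Lemma fin_eigenvalueP (R : realType) n (P : 'M[{poly R[i]}]_n) r z :
  is_nrank P r -> fin_eigenvalue P z <-> (\rank (mxeval P z) < r)%N.
Proof.
by move=> nr; split=> [[r' [/(is_nrank_uniq nr) <-]]|lt] //; exists r.
Qed.

Lemma fin_eigenvalue_regular (R : realType) n (P : 'M[{poly R[i]}]_n) z :
  \det P != 0 -> fin_eigenvalue P z <-> root (\det P) z.
Proof.
move=> nz; rewrite (fin_eigenvalueP z (is_nrank_regular nz)) rootE -mxeval_det.
rewrite ltn_neqAle rank_leq_row andbT -[_ == n]/(row_free (mxeval P z)).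
by rewrite row_free_unit unitmxE unitfE negbK.
Qed.

(** * Splitting off the left and right null spaces *)

(** [Y] and [X] complete to unimodular matrices. [D] need not be diagonal: only its determinant [g],
    whose roots are the eigenvalues, is used later. *)
Definition null_splitting (F : fieldType) r k (P : 'M[{poly F}]_(r + k))
    (Y : 'M[{poly F}]_(k, r + k)) (X : 'M[{poly F}]_(r + k, k)) (g : {poly F}) :=
  exists (E : 'M[{poly F}]_(r, r + k)) (G : 'M[{poly F}]_(r + k, r)) (D : 'M[{poly F}]_r),
    [/\ col_mx E Y \in unitmx, row_mx G X \in unitmx, \det D = g, g != 0
      & col_mx E Y *m P *m row_mx G X = block_mx D 0 0 (0 : 'M_k)].

Lemma null_splitting_exists (R : realType) r k (P : 'M[{poly R[i]}]_(r + k)) :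
  is_nrank P r -> exists Y X g, null_splitting P Y X g.
Proof.
case/smith_form_exists => dd [_ [[E [Q [uE [uQ EQ]]]] [mon _]]].
exists (dsubmx E), (rsubmx Q), (\prod_(i < r) dd i), (usubmx E), (lsubmx Q), (diag_mx (\row_(i < r) dd i)).
rewrite vsubmxK hsubmxK; split; try exact/unitmx_poly_det.
- by rewrite det_diag; apply: eq_bigr => i _; rewrite mxE.
- by apply/prodf_neq0 => i _; apply/monic_neq0/mon.
rewrite EQ; apply/matrixP => p q; rewrite mxE -!val_eqE.
case: (split_ordP p) => p' ->; case: (split_ordP q) => q' -> /=.
- by rewrite block_mxEul !mxE andbT -val_eqE; case: eqP.
- by rewrite block_mxEur mxE; case: eqP => // e; have := ltn_ord p'; rewrite e ltnNge leq_addr.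
- by rewrite block_mxEdl mxE andbF.
by rewrite block_mxEdr mxE andbF.
Qed.

Lemma null_splitting_tr (F : fieldType) r k (P : 'M[{poly F}]_(r + k)) Y X g :
  null_splitting P Y X g -> null_splitting P^T X^T Y^T g.
Proof.
move=> [E [G [D [uE uG Dg nzg EP]]]]; exists G^T, E^T, D^T.
rewrite -tr_row_mx -tr_col_mx !unitmx_tr det_tr; split=> //.
by rewrite -mulmxA -!trmx_mul EP tr_block_mx !trmx0.
Qed.

Lemma null_splitting_mulr (F : fieldType) r k (P : 'M[{poly F}]_(r + k)) Y X g
    (T : 'M[{poly F}]_k) :
  T \in unitmx -> null_splitting P Y X g -> null_splitting P Y (X *m T) g.
Proof.
move=> uT [E [G [D [uE uG Dg nzg EP]]]]; exists E, G, D.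
have EG : row_mx G (X *m T) = row_mx G X *m block_mx 1%:M 0 0 T.
  by rewrite mul_row_block !mulmx0 mulmx1 addr0 add0r.
have uB : block_mx (1%:M : 'M_r) 0 0 T \in unitmx.
  by rewrite unitmxE det_ublock det1 mul1r -unitmxE.
rewrite EG unitmx_mul uG uB; split=> //.
by rewrite mulmxA EP mulmx_block !mulmx0 !mul0mx mulmx1 !addr0.
Qed.

Lemma null_splitting_ker (F : fieldType) r k (P : 'M[{poly F}]_(r + k)) Y X g :
  null_splitting P Y X g -> P *m X = 0.
Proof.
move=> [E [G [D [uE uG _ _ EP]]]].
have : P *m row_mx G X = invmx (col_mx E Y) *m block_mx D 0 0 0.
  by rewrite -EP -mulmxA mulKmx.
by rewrite mul_mx_row block_mxEh mul_mx_row col_mx0 mulmx0 => /eq_row_mx[].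
Qed.

(** In the unimodular frame [row_mx G X], [D] kills the [G]-coordinates of [Z]. Although [D] may not
    be invertible over polynomials, [adj D * D = g] with [g] nonzero forces them to vanish, so the
    coefficients [T] are polynomial and not merely rational. *)
Lemma null_splitting_span (F : fieldType) r k p (P : 'M[{poly F}]_(r + k)) Y X g
    (Z : 'M[{poly F}]_(r + k, p)) :
  null_splitting P Y X g -> P *m Z = 0 -> exists T, Z = X *m T.
Proof.
move=> [E [G [D [uE uG Dg nzg EP]]]] PZ.
pose C := invmx (row_mx G X) *m Z.
have EZ : Z = G *m usubmx C + X *m dsubmx C.
  by rewrite -mul_row_col vsubmxK mulKVmx.
have : block_mx D 0 0 (0 : 'M_k) *m C = 0. 
  by rewrite -EP -(mulmxA _ _ C) mulKVmx // -mulmxA PZ mulmx0.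
rewrite -[C]vsubmxK mul_block_col !mul0mx !addr0 -[RHS]col_mx0 => /eq_col_mx[DC _].
have C0 : usubmx C = 0.
  have : \adj D *m (D *m usubmx C) = 0 by rewrite DC mulmx0.
  rewrite mulmxA mul_adj_mx mul_scalar_mx Dg => /matrixP C0; apply/matrixP => i j.
  have /eqP := C0 i j; rewrite [X in X == _]mxE [X in _ == X]mxE.
  by rewrite mulf_eq0 (negbTE nzg) => /eqP ->; rewrite mxE.
by exists (dsubmx C); rewrite {1}EZ C0 mulmx0 add0r.
Qed.

(* [col_mx E Y] and [row_mx G X] transform the perturbed matrix into the product
   [1 EU; 0 YU] [D 0; ZWG ZWX]. *)
Lemma null_splitting_det (F : fieldType) r k (P : 'M[{poly F}]_(r + k)) Y X g :
  null_splitting P Y X g -> exists2 c : F, c != 0 & forall (U : 'M[{poly F}]_(r + k, k)) Z W,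
    \det (P + U *m Z *m W) = c *: (g * \det (Y *m U) * \det Z * \det (W *m X)).
Proof.
move=> [E [G [D [uE uG <- _ EP]]]].
have /unitmx_poly_det[e [nze De]] := uE; have /unitmx_poly_det[f [nzf Df]] := uG.
exists (e * f)^-1 => [|U Z W]; first by rewrite invr_eq0 mulf_neq0.
have : \det (col_mx E Y *m (P + U *m Z *m W) *m row_mx G X)
   = \det (block_mx 1%:M (E *m U) 0 (Y *m U)) *
     \det (block_mx D 0 (Z *m W *m G) (Z *m W *m X)).
  rewrite -det_mulmx; congr determinant; rewrite mulmxDr mulmxDl EP !mulmx_block.
  rewrite !mul1mx !mul0mx !add0r.
  rewrite -(add0r (E *m U *m (Z *m W *m X))) -(add0r (Y *m U *m (Z *m W *m G))).
  rewrite -(add0r (Y *m U *m (Z *m W *m X))) -add_block_mx; congr (_ + _).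
  by rewrite !mulmxA mul_mx_row block_mxEh !mul_col_mx.
rewrite !det_mulmx det_ublock det_lblock det1 mul1r De Df -(mulmxA Z) det_mulmx.
rewrite mulrAC -polyCM mul_polyC => E1.
apply: (canRL (scalerK (mulf_neq0 nze nzf))); rewrite E1.
move: (\det (Y *m U)) (\det Z) (\det (W *m X)) (\det D) => a b c h.
by rewrite mulrCA !mulrA.
Qed.

Lemma null_splitting_rank (R : realType) r k (P : 'M[{poly R[i]}]_(r + k)) Y X g z :
  null_splitting P Y X g -> (\rank (mxeval P z) < r)%N = root g z.
Proof.
move=> [E [G [D [uE uG <- _ EP]]]].
have -> : \rank (mxeval P z) = \rank (mxeval D z).
  transitivity (\rank (mxeval (col_mx E Y *m P *m row_mx G X) z)).
    have uEz := mxeval_unit z uE; have uGz := mxeval_unit z uG.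
    by rewrite !mxevalM mxrankMfree ?row_free_unit // eqmxMfull // row_full_unit.
  rewrite EP /mxeval map_block_mx !(map_mx0 (horner_eval z)).
  by rewrite rank_diag_block_mx mxrank0 addn0.
rewrite ltn_neqAle rank_leq_row andbT -[_ == r]/(row_free (mxeval D z)).
by rewrite row_free_unit unitmxE unitfE negbK mxeval_det.
Qed.

(** Pointwise analogue of [null_splitting_span]; away from the roots of [g], [D] evaluated at [z] is
    invertible. *)
Lemma null_splitting_ker_eval (R : realType) r k p (P : 'M[{poly R[i]}]_(r + k)) Y X g z
    (x : 'M_(r + k, p)) :
  null_splitting P Y X g -> ~~ root g z -> mxeval P z *m x = 0 ->
  exists c, x = mxeval X z *m c.
Proof.
move=> [E [G [D [uE uG Dg nzg EP]]]] nr Px.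
pose C := invmx (mxeval (row_mx G X) z) *m x.
have Ex : x = mxeval G z *m usubmx C + mxeval X z *m dsubmx C.
  by rewrite -mul_row_col vsubmxK -map_row_mx mulKVmx // mxeval_unit.
have : mxeval (block_mx D 0 0 (0 : 'M_k)) z *m C = 0.
  by rewrite -EP mxevalM -(mulmxA _ _ C) mulKVmx ?mxeval_unit // mxevalM -mulmxA Px mulmx0.
rewrite -[C]vsubmxK /mxeval map_block_mx !(map_mx0 (horner_eval z)).
rewrite mul_block_col !mul0mx !addr0 -[RHS]col_mx0 => /eq_col_mx[DC _].
have uD : mxeval D z \in unitmx by rewrite unitmxE unitfE mxeval_det Dg.
have C0 : usubmx C = 0 by rewrite -(mulKmx uD (usubmx C)) DC mulmx0.
by exists (dsubmx C); rewrite {1}Ex C0 mulmx0 add0r.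
Qed.

(** A unimodular matrix is invertible at every point, so its columns [X] stay independent even at
    eigenvalues. *)
Lemma null_splitting_linv (R : realType) r k (P : 'M[{poly R[i]}]_(r + k)) Y X g z :
  null_splitting P Y X g -> exists W, W *m mxeval X z = 1%:M.
Proof.
move=> [E [G [D [_ uG _ _ _]]]].
exists (dsubmx (invmx (mxeval (row_mx G X) z))).
have := mulVmx (mxeval_unit z uG); rewrite {2}/mxeval map_row_mx.
by rewrite -{1}[invmx _]vsubmxK mul_col_row scalar_mx_block => /eq_block_mx[].
Qed.

(** * Minimal bases *)

Lemma tofrac_mxM (R : realType) m n p (A : 'M[{poly R[i]}]_(m, n)) (B : 'M_(n, p)) :
  tofrac_mx (A *m B) = tofrac_mx A *m tofrac_mx B.
Proof. exact: map_mxM. Qed.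

Lemma tofrac_mx0 (R : realType) m n : tofrac_mx (0 : 'M[{poly R[i]}]_(m, n)) = 0.
Proof. exact: map_mx0. Qed.

Lemma tofrac_mx_inj (R : realType) m n : injective (@tofrac_mx R m n).
Proof.
move=> A B /matrixP AB; apply/matrixP => i j.
by have := AB i j; rewrite !mxE => /eqP; rewrite tofrac_eq => /eqP.
Qed.

Lemma poly_basis_inj (R : realType) n k p (P : 'M[{poly R[i]}]_n) (X : 'M_(n, k))
    (c : 'M_(k, p)) :
  right_poly_basis P X -> X *m c = 0 -> c = 0.
Proof.
move=> [_ [rf _]] Xc; apply: trmx_inj; apply: tofrac_mx_inj.
have : tofrac_mx c^T *m (tofrac_mx X)^T = 0.
  by rewrite /tofrac_mx -map_trmx -trmx_mul -map_mxM Xc map_mx0 trmx0.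
by move/eqP; rewrite mulmx_free_eq0 // => /eqP ->; rewrite trmx0 tofrac_mx0.
Qed.

Lemma size_le_vdeg (R : realType) n k (X : 'M[{poly R[i]}]_(n, k)) i j :
  (size (X i j) <= (vdeg X j).+1)%N.
Proof.
by apply: leq_trans (leqSpred _); rewrite (leq_bigmax (F := fun i => size (X i j))).
Qed.

Lemma unitmx_replace_col (F : fieldType) k (w : 'cV[F]_k) j : w j 0 != 0 ->
  \matrix_(a, l) (if l == j then w a 0 else (a == l)%:R) \in unitmx.
Proof.
move=> nz; rewrite unitmxE (expand_det_row _ j) (bigD1 j) //= big1 => [|l nl].
  rewrite addr0 mxE eqxx /cofactor addnn -signr_odd odd_double mul1r.
  rewrite (_ : row' _ _ = 1%:M) ?det1 ?mulr1 ?unitfE //.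
  apply/matrixP => a b; rewrite !mxE eq_sym (negbTE (neq_lift _ _)).
  by rewrite (inj_eq lift_inj).
by rewrite mxE (negbTE nl) eq_sym (negbTE nl) mul0r.
Qed.

(* Exchanging the column [j] for [x] yields another polynomial basis. *)
Lemma minimal_basis_exchange (R : realType) n k (P : 'M[{poly R[i]}]_n) (X : 'M_(n, k))
    (x : 'cV[{poly R[i]}]_n) (c : 'cV[{poly R[i]}]_k) (q : {poly R[i]}) j :
  right_minimal_basis P X -> q != 0 -> q *: x = X *m c -> c j 0 != 0 ->
  (vdeg X j <= vdeg x 0%R)%N.
Proof.
move=> [[PX [rf span]] min] nzq qx nzc.
pose X' := \matrix_(i, l) (if l == j then x i 0 else X i l).
(* Over the fraction field, [w] is the coordinate vector of [x] in the basis [X]; the change of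
   basis [T] is invertible because its entry [w j] is nonzero. *)
pose w := ((FracField.tofrac q))^-1 *: tofrac_mx c.
pose T := \matrix_(a, l) (if l == j then w a 0 else (a == l)%:R).
have nzqF : (FracField.tofrac q) != 0 by rewrite tofrac_eq0.
have uT : T \in unitmx.
  by apply: unitmx_replace_col; rewrite !mxE mulf_neq0 ?invr_eq0 ?tofrac_eq0.
have EX' : tofrac_mx X' = tofrac_mx X *m T.
  apply/matrixP => a l; rewrite !mxE; case: (eqVneq l j) => [->|nl].
    have := congr1 (fun M => (tofrac_mx M) a 0) qx; rewrite tofrac_mxM !mxE tofracM.
    move/(canRL (mulKf nzqF)) ->; rewrite mulr_sumr; apply: eq_bigr => l' _.
    by rewrite !mxE eqxx mulrCA.
  rewrite (bigD1 l) //= big1 => [|l' nl']; last by rewrite !mxE (negbTE nl) (negbTE nl') mulr0.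
  by rewrite !mxE (negbTE nl) eqxx mulr1 addr0.
have basis' : right_poly_basis P X'.
  split; [|split].
  - by apply: tofrac_mx_inj; rewrite tofrac_mxM EX' mulmxA -tofrac_mxM PX !tofrac_mx0 mul0mx.
  - by rewrite /row_free EX' trmx_mul eqmxMfull // row_full_unit unitmx_tr.
  move=> y /span[d ->]; exists (invmx T *m d).
  by rewrite EX' -mulmxA mulKVmx.
have := min _ basis'; rewrite (bigD1 j) //= [Z in (_ <= Z)%N](bigD1 j) //=.
have -> : vdeg X' j = vdeg x 0.
  by congr _.-1; apply: eq_bigr => i _; rewrite mxE eqxx.
rewrite [Z in (_ <= _ + Z)%N](eq_bigr (vdeg X)) ?leq_add2r // => l nl.
by congr _.-1; apply: eq_bigr => i _; rewrite mxE (negbTE nl).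
Qed.

(** The strict form of the exchange, stated with sizes because [vdeg] is a truncated predecessor and
    does not separate zero from constant columns. In degree 0 the contradiction comes from
    independence instead of minimality. *)
Lemma minimal_basis_no_drop (R : realType) n k (P : 'M[{poly R[i]}]_n) (X : 'M_(n, k))
    (x : 'cV[{poly R[i]}]_n) (c : 'cV[{poly R[i]}]_k) (q : {poly R[i]}) j :
  right_minimal_basis P X -> q != 0 -> q *: x = X *m c -> c j 0 != 0 ->
  ~ (forall i, (size (x i 0%R) <= vdeg X j)%N).
Proof.
move=> mX nzq qx nzc small.
have := minimal_basis_exchange mX nzq qx nzc.
have : (vdeg x 0%R <= (vdeg X j).-1)%N.
  by rewrite {1}/vdeg -!subn1 leq_sub2r //; apply/bigmax_leqP => i _.
have [d0 _ _|dpos le1 /leq_trans/(_ le1)] := posnP (vdeg X j); last by rewrite leqNgt prednK ?leqnn.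
have x0 : x = 0.
  apply/matrixP => i l; rewrite ord1 mxE; apply/eqP; rewrite -size_poly_eq0 -leqn0.
  by have := small i; rewrite d0.
have /(poly_basis_inj mX.1) c0 : X *m c = 0 by rewrite -qx x0 scaler0.
by rewrite c0 mxE eqxx in nzc.
Qed.

(** Selects the column to exchange: one of largest degree among those occurring in the
    combination. *)
Lemma max_vdeg_support (R : realType) n k (X : 'M[{poly R[i]}]_(n, k)) (c : 'cV[R[i]]_k) :
  c != 0 -> exists2 j, c j 0 != 0 & forall l, c l 0 != 0 -> (vdeg X l <= vdeg X j)%N.
Proof.
move=> nzc; have [j0 nz0] : exists j, c j 0 != 0.
  apply: contrapT => /forallNP h; case/eqP: nzc; apply/matrixP => j l.
  by rewrite ord1 mxE; apply/eqP/negPn/negP/h.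
have [j nzj maxj] := arg_maxnP (P := fun j => c j 0 != 0) (vdeg X) nz0.
by exists j.
Qed.

(** A combination vanishing at [z] is divisible by ['X - z], and the quotient has smaller degree
    than the largest column involved, which it could replace. *)
Lemma minimal_basis_eval_inj (R : realType) n k (P : 'M[{poly R[i]}]_n) (X : 'M_(n, k)) z
    (c : 'cV_k) :
  right_minimal_basis P X -> mxeval X z *m c = 0 -> c = 0.
Proof.
move=> mX Xc; apply/eqP/negPn/negP => /(max_vdeg_support X)[j nzj maxj].
pose y := X *m map_mx polyC c.
have yE i : y i 0 = \sum_l c l 0 *: X i l.
  by rewrite mxE; apply: eq_bigr => l _; rewrite mxE mulrC mul_polyC.
have yz i : root (y i 0) z.
  rewrite /root yE horner_sum; have := congr1 (fun M : 'cV_n => M i 0) Xc.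
  rewrite !mxE => {2}<-; apply/eqP; apply: eq_bigr => l _.
  by rewrite hornerZ mxE mulrC.
have nzX : 'X - z%:P != 0 by rewrite polyXsubC_eq0.
apply: (@minimal_basis_no_drop _ _ _ P X (\col_i (y i 0 %/ ('X - z%:P)))
  (map_mx polyC c) ('X - z%:P) j) => //.
- apply/matrixP => i l; rewrite ord1 [LHS]mxE [Z in _ * Z]mxE mulrC divpK //.
  by rewrite dvdp_XsubCl yz.
- by rewrite mxE polyC_eq0.
move=> i; rewrite mxE size_divp // size_XsubC leq_subLR add1n yE.
apply: leq_trans (size_sum _ _ _) _; apply/bigmax_leqP => l _.
have [->|nzl] := eqVneq (c l 0) 0; first by rewrite scale0r size_poly0.
by rewrite size_scale // (leq_trans (size_le_vdeg _ _ _)) // ltnS maxj.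
Qed.

(** The highest column degree coefficient matrix; its injectivity is column reducedness. *)
Definition lead_mx (R : realType) n k (X : 'M[{poly R[i]}]_(n, k)) : 'M[R[i]]_(n, k) :=
  \matrix_(i, l) (X i l)`_(vdeg X l).

(** Powers of the variable raise all columns involved to the largest degree among them; a relation
    between leading coefficients then cancels the top term. The exponent is 0 at [j], so column [j]
    can be exchanged. *)
Lemma minimal_basis_lead_inj (R : realType) n k (P : 'M[{poly R[i]}]_n) (X : 'M_(n, k))
    (c : 'cV_k) :
  right_minimal_basis P X -> lead_mx X *m c = 0 -> c = 0.
Proof.
move=> mX Lc; apply/eqP/negPn/negP => /(max_vdeg_support X)[j nzj maxj].
pose c' : 'cV_k := \col_l (c l 0 *: 'X^(vdeg X j - vdeg X l)).
apply: (@minimal_basis_no_drop _ _ _ P X (X *m c') c' 1 j) => //.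
- exact: oner_neq0.
- by rewrite scale1r.
- by rewrite mxE subnn expr0 scaler_eq0 oner_eq0 orbF.
move=> i; have szl l : (size (X i l * c' l 0)%R <= (vdeg X j).+1)%N.
  rewrite mxE -scalerAr; have [->|nzl] := eqVneq (c l 0) 0; first by rewrite scale0r size_poly0.
  rewrite size_scale //; apply: leq_trans (size_polyMleq _ _) _.
  rewrite size_polyXn addnS /=.
  by apply: leq_trans (leq_add (size_le_vdeg X i l) (leqnn _)) _; rewrite addSn subnKC ?maxj.
have szx : (size ((X *m c') i 0%R) <= (vdeg X j).+1)%N.
  by rewrite mxE (leq_trans (size_sum _ _ _)) //; apply/bigmax_leqP => l _.
apply/leq_sizeP => m; rewrite leq_eqVlt => /predU1P[<-|lt]; last first.
  by rewrite nth_default // (leq_trans szx).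
transitivity ((lead_mx X *m c) i 0); last by rewrite Lc mxE.
rewrite mxE coef_sum [RHS]mxE; apply: eq_bigr => l _; rewrite !mxE -scalerAr coefZ mulrC.
have [->|nzl] := eqVneq (c l 0) 0; first by rewrite !mulr0.
by rewrite coefMXn ltnNge leq_subr /= subKn // maxj.
Qed.

Lemma left_inverse_of_inj (F : fieldType) n k (K : 'M[F]_(n, k)) :
  (forall c : 'cV_k, K *m c = 0 -> c = 0) -> exists W, W *m K = 1%:M.
Proof.
move=> inj; have : row_free K^T.
  rewrite -kermx_eq0; apply/eqP; apply/row_matrixP => i; rewrite row0.
  have : row i (kermx K^T) *m K^T = 0 by rewrite -row_mul mulmx_ker row0.
  move/(congr1 trmx); rewrite trmx_mul trmxK trmx0 => /inj /(congr1 trmx).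
  by rewrite trmxK trmx0.
case/row_freeP => W KW; exists W^T.
by rewrite -[K]trmxK -trmx_mul KW trmx1.
Qed.

(** The minimal basis is [X *m T] with [T] polynomial. A root of [det T] would make the minimal
    basis dependent at that point, so [det T] is a nonzero constant. *)
Lemma null_splitting_minimal_right (R : realType) r k (P : 'M[{poly R[i]}]_(r + k)) Y X g Xm :
  null_splitting P Y X g -> right_minimal_basis P Xm -> null_splitting P Y Xm g.
Proof.
move=> sp mX; have [T ET] := null_splitting_span sp mX.1.1.
rewrite ET; apply: null_splitting_mulr sp.
apply/unitmx_poly_det; have [/size_poly1P[c nzc ->]|/closed_rootP[z]] := boolP (size (\det T) == 1%N).
  by exists c.
rewrite /root -mxeval_det -det_tr => /det0P[v nzv vT].
have /(minimal_basis_eval_inj mX) v0 : mxeval Xm z *m v^T = 0.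
  by rewrite ET mxevalM -mulmxA -[mxeval T z]trmxK -trmx_mul vT trmx0 mulmx0.
by case/eqP: nzv; rewrite -[v]trmxK v0 trmx0.
Qed.

Lemma null_splitting_minimal (R : realType) r k (P : 'M[{poly R[i]}]_(r + k)) X Y :
  is_nrank P r -> right_minimal_basis P X -> right_minimal_basis P^T Y ->
  exists g, null_splitting P Y^T X g.
Proof.
move=> /null_splitting_exists[Y0 [X0 [g sp]]] mX mY; exists g.
have /null_splitting_tr sp1 := null_splitting_minimal_right sp mX.
have /null_splitting_tr := null_splitting_minimal_right sp1 mY.
by rewrite !trmxK.
Qed.

(** * Determinants of polynomial matrices with bounded column degrees *)

Lemma coefM_top (T : comNzRingType) (p q : {poly T}) a b :
  (size p <= a.+1)%N -> (size q <= b.+1)%N ->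
  (size (p * q)%R <= (a + b).+1)%N /\ (p * q)`_(a + b) = p`_a * q`_b.
Proof.
move=> szp szq; split.
  apply: leq_trans (size_polyMleq _ _) _; rewrite -subn1 leq_subLR add1n.
  by rewrite -addnS -addSn leq_add.
rewrite coefM (bigD1 (inord a)) //= inordK ?ltnS ?leq_addr // addKn.
rewrite big1 ?addr0 // => l; rewrite -val_eqE /= inordK ?ltnS ?leq_addr // => nl.
have [lt|gt|e] := ltngtP l a; last by rewrite e eqxx in nl.
  rewrite [X in _ * X]nth_default ?mulr0 // (leq_trans szq) //.
  by rewrite ltn_subRL ltn_add2r.
by rewrite nth_default ?mul0r // (leq_trans szp).
Qed.

(** Each Leibniz term takes exactly one entry from every column, so its degree is bounded by the sum
    of the column bounds, and its coefficient there is the product of the top coefficients. *)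
Lemma coef_det_top (T : comNzRingType) k (A : 'M[{poly T}]_k) (e : 'I_k -> nat) :
  (forall i j, (size (A i j) <= (e j).+1)%N) ->
  (size (\det A) <= (\sum_j e j).+1)%N /\
  (\det A)`_(\sum_j e j) = \det (\matrix_(i, j) (A i j)`_(e j)).
Proof.
move=> szA.
have term (s : {perm 'I_k}) : (size (\prod_i A i (s i))%R <= (\sum_j e j).+1)%N /\
    (\prod_i A i (s i))`_(\sum_j e j) = \prod_i (A i (s i))`_(e (s i)).
  have -> : (\sum_j e j = \sum_i e (s i))%N by rewrite (reindex_inj (@perm_inj _ s)).
  elim/big_rec3: _ => [|i c m p _ [szp <-]]; first by rewrite size_poly1 coef1.
  by have [] := coefM_top (szA i (s i)) szp.
split.
  apply: leq_trans (size_sum _ _ _) _; apply/bigmax_leqP => s _.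
  by rewrite size_Msign; have [] := term s.
rewrite coef_sum; apply: eq_bigr => s _.
have -> : \prod_i (\matrix_(i, j) (A i j)`_(e j)) i (s i) = \prod_i (A i (s i))`_(e (s i)).
  by apply: eq_bigr => i _; rewrite mxE.
by have [_ <-] := term s; case: odd_perm; rewrite ?expr0 ?expr1 ?mul1r // !mulN1r coefN.
Qed.

Lemma coef_det_mull (T : comNzRingType) n k (W : 'M[T]_(k, n)) (X : 'M[{poly T}]_(n, k))
    (e : 'I_k -> nat) :
  (forall i j, (size (X i j) <= (e j).+1)%N) ->
  (size (\det (map_mx polyC W *m X)) <= (\sum_j e j).+1)%N /\
  (\det (map_mx polyC W *m X))`_(\sum_j e j) =
    \det (W *m \matrix_(i, j) (X i j)`_(e j)).
Proof.
move=> szX; have [|sz ->] := @coef_det_top _ _ (map_mx polyC W *m X) e.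
  move=> i j; rewrite mxE (leq_trans (size_sum _ _ _)) //; apply/bigmax_leqP => l _.
  by rewrite mxE mul_polyC (leq_trans (size_scale_leq _ _)).
split=> //; congr determinant; apply/matrixP => i j; rewrite !mxE coef_sum.
by apply: eq_bigr => l _; rewrite !mxE coefCM.
Qed.

(** * Generic members of a pencil have no double root *)

(** The nonvanishing hypothesis, in place of characteristic 0, makes this applicable also to
    coefficients that are polynomials in the entries of [(U, W)]. *)
Lemma lead_coef_deriv (T : nzRingType) (p : {poly T}) :
  lead_coef p *+ (size p).-1 != 0 -> lead_coef p^`() = lead_coef p *+ (size p).-1.
Proof.
case Ep: (size p) => [|[|s]] nz; try by rewrite mulr0n eqxx in nz.
have cs : (p^`())`_s = lead_coef p *+ s.+1 by rewrite coef_deriv lead_coefE Ep.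
rewrite lead_coefE; suff -> : size p^`() = s.+1 by [].
apply/eqP; rewrite eqn_leq; apply/andP; split.
  by have := lt_size_deriv (p := p); rewrite -size_poly_eq0 Ep ltnS => ->.
by rewrite ltnNge; apply/negP => sz; rewrite -cs nth_default ?eqxx in nz.
Qed.

Lemma lead_coef_deriv_char0 (C : numDomainType) (p : {poly C}) :
  lead_coef p^`() = lead_coef p *+ (size p).-1.
Proof.
have [sz|sz] := leqP (size p) 1.
  have -> : p = (p`_0)%:P by apply: size1_polyC.
  by rewrite derivC lead_coef0 size_polyC; case: (_ != _); rewrite mulr0n.
by rewrite lead_coef_deriv // mulrn_eq0 lead_coef_eq0 -size_poly_eq0; case: (size p) sz => [|[]].
Qed.

(** Leading coefficients show that nonzero solutions of the equation have the same degree.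
    Subtracting the multiple of [q] that cancels the leading term gives a solution of smaller
    degree, hence zero. *)
Lemma proportional_of_wronskian (C : numFieldType) (p q : {poly C}) :
  q != 0 -> p * q^`() = q * p^`() -> exists a, p = a *: q.
Proof.
have szE (u v : {poly C}) : u != 0 -> v != 0 -> u * v^`() = v * u^`() -> size u = size v.
  move=> nzu nzv e0; have := congr1 (fun f : {poly C} => lead_coef f) e0.
  rewrite /= !lead_coefM !lead_coef_deriv_char0 !mulrnAr [lead_coef v * _]mulrC.
  rewrite -[LHS]mulr_natr -[RHS]mulr_natr => /mulfI e.
  have : (size v).-1%:R = (size u).-1%:R :> C.
    by apply: e; rewrite mulf_neq0 ?lead_coef_eq0.
  move/eqP; rewrite eqr_nat => /eqP e1.
  by rewrite -(prednK (n := size u)) ?size_poly_gt0 // -e1 prednK ?size_poly_gt0.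
move=> nzq wr; have [->|nzp] := eqVneq p 0; first by exists 0; rewrite scale0r.
have szpq := szE _ _ nzp nzq wr.
pose a := lead_coef p / lead_coef q; exists a; apply/eqP; rewrite -subr_eq0.
have nza : a != 0 by rewrite mulf_neq0 ?invr_eq0 ?lead_coef_eq0.
apply/negPn/negP => nzr.
have /(szE _ _ nzr nzq) szr : (p - a *: q) * q^`() = q * (p - a *: q)^`().
  by rewrite derivB derivZ mulrBl mulrBr wr -scalerAl scalerAr.
have : (size (p - a *: q)%R < size q)%N.
  have szq : (0 < size q)%N by rewrite size_poly_gt0.
  rewrite -(prednK szq) ltnS; apply/leq_sizeP => m.
  rewrite leq_eqVlt => /predU1P[<-|lt]; rewrite coefB coefZ.
    rewrite -{1}szpq -!lead_coefE /a divfK ?subrr //.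
    by rewrite lead_coef_eq0.
  by rewrite !nth_default ?mulr0 ?subr0 ?szpq // -(prednK szq).
by rewrite szr ltnn.
Qed.

(** It holds everywhere for the zero polynomial, so excluding it also excludes vanishing. *)
Definition double_root (C : fieldType) (p : {poly C}) z := root p z && root p^`() z.

Lemma mup_le1 (C : fieldType) (p : {poly C}) z :
  p != 0 -> ~~ double_root p z -> (mup z p <= 1)%N.
Proof.
move=> nzp; apply: contraNT; rewrite -ltnNge mup_geq // => /dvdpP[q ->].
rewrite /double_root /root derivM expr2 derivM derivXsubC.
by rewrite !(hornerXsubC, hornerM, hornerD, subrr, mulr0, mul0r, addr0) eqxx.
Qed.

Lemma coprimep_deriv (C : closedFieldType) (p : {poly C}) :
  (forall z, ~~ double_root p z) <-> coprimep p p^`().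
Proof.
split=> [nd|/coprimep_root cop z]; last by rewrite negb_and -implybE; apply/implyP => /cop.
apply/Pdiv.ClosedField.coprimepP => z pz; have := nd z.
by rewrite /double_root pz.
Qed.

Lemma roots_seq (C : closedFieldType) (p : {poly C}) : p != 0 ->
  exists2 rs, forall z, count_mem z rs = mup z p & size rs = (size p).-1.
Proof.
move=> nzp; have [rs Ep] := closed_field_poly_normal p.
have nzl : lead_coef p != 0 by rewrite lead_coef_eq0.
exists rs => [z|]; rewrite [in RHS]Ep.
  by rewrite -mul_polyC mupMr ?mu_prod_XsubC // rootC.
by rewrite size_scale // size_prod_XsubC.
Qed.

Lemma fresh_point (C : numDomainType) (s : seq C) : exists t, t \notin s.
Proof.
have [t] : exists t, (\prod_(z <- s) ('X - z%:P)).[t] != 0.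
  by apply: poly_nonroot; rewrite monic_neq0 // monic_prod_XsubC.
by rewrite -[_ == 0]/(root _ _) root_prod_XsubC; exists t.
Qed.

Lemma finite_bad_params (C : eqType) (D : eqType) (bad : D -> C -> Prop) (zs : seq D) :
  (forall z t t', bad z t -> bad z t' -> t = t') ->
  exists ts : seq C, forall z t, z \in zs -> bad z t -> t \in ts.
Proof.
move=> uniq_bad; elim: zs => [|z zs [ts IH]]; first by exists [::].
have [[t0 b0]|/forallNP nb] := pselect (exists t, bad z t); last first.
  by exists ts => y t; rewrite inE => /predU1P[->/nb//|/IH]; apply.
exists (t0 :: ts) => y t; rewrite !inE => /predU1P[->/(uniq_bad _ _ _ b0)->|yzs /(IH _ _ yzs)->].
  by rewrite eqxx.
by rewrite orbT.
Qed.

(* A bad parameter [t] at [z] solves [u + t v = 0] for the vectors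
   [u = (p_s(z), p_s'(z))_s] and [v = (q_s(z), q_s'(z))_s], which do not both
   vanish.  Either a 2x2 minor of [(u, v)] is a nonzero polynomial in [z], and
   only its finitely many roots can be bad, or [p = a q] for a constant [a]. *)
Lemma pencil_no_double_root (C : numClosedFieldType) (S : Type) (p q : S -> {poly C}) :
  (forall z, exists s, ~~ (double_root (p s) z && double_root (q s) z)) ->
  exists bad : seq C, forall t, t \notin bad ->
    forall z, exists s, ~~ double_root (p s + t *: q s) z.
Proof.
move=> good.
pose bad z t := forall s, double_root (p s + t *: q s) z.
have drE s z t : double_root (p s + t *: q s) z =
    ((p s).[z] + t * (q s).[z] == 0) && ((p s)^`().[z] + t * (q s)^`().[z] == 0).
  by rewrite /double_root /root derivD derivZ !hornerE.
have uniq_bad z t t' : bad z t -> bad z t' -> t = t'.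
  (* Two bad parameters at the same [z] would make every [p s] and [q s] have a double root
     there. *)
  move=> b b'; apply/eqP/negPn/negP => ntt'; have [s] := good z; case/negP.
  have sol (a c : C) : a + t * c == 0 -> a + t' * c == 0 -> c == 0 /\ a == 0.
    move=> /eqP e /eqP e'; have /eqP : (t - t') * c = 0.
      rewrite mulrBl -[LHS]add0r -[in LHS](subrr a) addrACA -opprD.
      by rewrite e e' subrr.
    by rewrite mulf_eq0 subr_eq0 (negbTE ntt') /= => /eqP c0; move: e; rewrite c0 mulr0 addr0 => ->.
  move: (b s) (b' s); rewrite !drE => /andP[e1 e2] /andP[e1' e2'].
  have [q1 p1] := sol _ _ e1 e1'; have [q2 p2] := sol _ _ e2 e2'.
  by rewrite /double_root /root p1 p2 q1 q2.
have finish m : m != 0 -> (forall z t, bad z t -> root m z) ->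
    exists ts : seq C, forall t, t \notin ts ->
      forall z, exists s, ~~ double_root (p s + t *: q s) z.
  move=> nzm mz; have [rs Ers _] := roots_seq nzm.
  have [ts Ets] := finite_bad_params rs uniq_bad.
  exists ts => t nt z; apply: contrapT => /forallNP nb.
  have b : bad z t by move=> s; apply/negPn/negP; apply: nb.
  case/negP: nt; apply: (Ets z) => //.
  by rewrite -has_pred1 has_count Ers -XsubC_dvd // dvdp_XsubCl (mz _ _ b).
have minor0 (a b c d t : C) : a + t * b == 0 -> c + t * d == 0 -> a * d - b * c == 0.
  rewrite [a + _ == 0]addr_eq0 [c + _ == 0]addr_eq0 => /eqP-> /eqP->.
  by rewrite mulrN mulNr opprK -mulrA [b * (t * d)]mulrCA addNr.
(* The minors tried are the Wronskians, for one index, and then the minors of values for two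
   indices; if all vanish, the first kind gives proportionality at one index and the second spreads
   the same constant to all. *)
have [[s nzm]|/forallNP wr] := pselect (exists s, p s * (q s)^`() - q s * (p s)^`() != 0).
  apply: (finish _ nzm) => z t /(_ s); rewrite drE => /andP[e1 e2].
  by rewrite /root !hornerE (minor0 _ _ _ _ _ e1 e2).
have [[s [s' nzm]]|/forallNP mi] := pselect (exists s s', p s * q s' - q s * p s' != 0).
  apply: (finish _ nzm) => z t b; move: (b s) (b s'); rewrite !drE => /andP[e1 _] /andP[e2 _].
  by rewrite /root !hornerE (minor0 _ _ _ _ _ e1 e2).
have [[s0 nzq]|/forallNP q0] := pselect (exists s, q s != 0); last first.
  exists [::] => t _ z; have [s gs] := good z; exists s; move: gs.
  have -> : q s = 0 by apply/eqP/negPn/negP/q0.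
  rewrite scaler0 addr0; apply: contra => dp.
  by rewrite dp /double_root deriv0 !root0.
have [a Ea] : exists a, p s0 = a *: q s0.
  apply: proportional_of_wronskian => //; apply/eqP; rewrite -subr_eq0.
  by apply/negPn/negP/wr.
have Ep s : p s = a *: q s.
  have /negP/negPn : ~ (p s * q s0 - q s * p s0 != 0) by move=> nz; apply: (mi s); exists s0.
  rewrite subr_eq0 Ea -scalerAr scalerAl => /eqP; exact: mulIf.
(* Now [p s + t *: q s] is [(a + t) *: q s], which degenerates only for [t = - a]. *)
exists [:: - a] => t; rewrite inE => nt z; have [s gs] := good z; exists s; move: gs.
rewrite Ep -scalerDl; have nzat : a + t != 0 by rewrite addrC addr_eq0.
apply: contra => /andP[]; rewrite derivZ !rootZ // => q1 q2.
rewrite /double_root q1 q2 derivZ /root !hornerZ (eqP q1) (eqP q2).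
by rewrite !mulr0 eqxx.
Qed.

(* One coordinate at a time, the hypothesis is preserved by a generic
   specialisation: this is [pencil_no_double_root] for the family indexed by
   the values of the remaining coordinates. *)
Lemma multiaffine_no_double_root (C : numClosedFieldType) (I : finType)
    (F : (I -> C) -> {poly C}) D :
  (forall w i t, F [eta w with i |-> t] =
     (1 - t) *: F [eta w with i |-> 0] + t *: F [eta w with i |-> 1]) ->
  (forall z, exists w, ~~ double_root (F w) z) -> (exists w, (F w)`_D != 0) ->
  exists w, (forall z, ~~ double_root (F w) z) /\ (F w)`_D != 0.
Proof.
move=> affine good lead.
(* Coordinates in [L] are still free, the others are frozen at [w]. *)
pose merge (L : seq I) (w s : I -> C) j := if j \in L then s j else w j.
suff step (L : seq I) w : uniq L ->
    (forall z, exists s, ~~ double_root (F (merge L w s)) z) ->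
    (exists s, (F (merge L w s))`_D != 0) ->
    exists w, (forall z, ~~ double_root (F w) z) /\ (F w)`_D != 0.
  have mE s : merge (enum I) (fun=> 0) s = s by apply: funext => j; rewrite /merge mem_enum.
  apply: (step (enum I) (fun=> 0) (enum_uniq _)) => [z|].
    by have [s gs] := good z; exists s; rewrite mE.
  by have [s ls] := lead; exists s; rewrite mE.
elim: L w => [|i L IH] w.
  have mE s : merge [::] w s = w by apply: funext.
  move=> _ good0 [s lead0]; exists w; split; last by rewrite mE in lead0.
  by move=> z; have [s'] := good0 z; rewrite mE.
case/andP => niL uL good0 [s1 lead1].
have mE s t : merge L [eta w with i |-> t] s = [eta merge L w s with i |-> t].
  apply: funext => j; rewrite /merge /=; case: (eqVneq j i) => [->|//].
  by rewrite (negbTE niL).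
have mEi s : merge (i :: L) w s = [eta merge L w s with i |-> s i].
  by apply: funext => j; rewrite /merge inE /=; case: eqP => // ->.
pose p s := F [eta merge L w s with i |-> 0].
pose q s := F [eta merge L w s with i |-> 1] - p s.
have Ft s t : F [eta merge L w s with i |-> t] = p s + t *: q s.
  by rewrite affine scalerBl scale1r -/(p s) /q scalerBr -addrA [- _ + _]addrC.
clearbody q p.
have [z|bad nbad] := @pencil_no_double_root C _ p q.
  have [s gs] := good0 z; exists s; move: gs; rewrite mEi Ft; apply: contra => /andP[dp dq].
  move: dp dq; rewrite /double_root /root derivD derivZ !hornerE => /andP[/eqP-> /eqP->] /andP[/eqP-> /eqP->].
  by rewrite mulr0 addr0 eqxx.
rewrite mEi Ft coefD coefZ in lead1.
(* The coefficient of index [D], affine in [t] and not identically zero; [t] is chosen off its roots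
   and off [bad]. *)
pose l : {poly C} := ((p s1)`_D)%:P + ((q s1)`_D)%:P * 'X.
have lE t : l.[t] = (p s1)`_D + t * (q s1)`_D by rewrite !hornerE mulrC.
have nzl : l != 0 by apply: contraNneq lead1 => l0; rewrite -lE l0 horner0.
have [t] : exists t, (l * \prod_(z <- bad) ('X - z%:P)).[t] != 0.
  by apply: poly_nonroot; rewrite mulf_neq0 // monic_neq0 // monic_prod_XsubC.
rewrite hornerM mulf_eq0 negb_or lE => /andP[lt].
rewrite -[_ == 0]/(root _ _) root_prod_XsubC => nt.
apply: (IH [eta w with i |-> t]) => // [z|].
  by have [s gs] := nbad t nt z; exists s; rewrite mE Ft.
by exists s1; rewrite mE Ft coefD coefZ.
Qed.

(** * Generic perturbations *)

(** Nontriviality of the polynomial is witnessed by a point, so that one good [(U, W)] is enough. *)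
Definition generically (C : fieldType) m (Q : ('I_m -> C) -> Prop) :=
  exists p : {mpoly C[m]}, (exists v, p.@[v] != 0) /\ forall v, p.@[v] != 0 -> Q v.

Lemma horner_mmap (C : fieldType) m (h : 'I_m -> {poly C}) (p : {mpoly C[m]}) t :
  (mmap polyC h p).[t] = p.@[fun i => (h i).[t]].
Proof.
rewrite /mmap horner_sum mevalE; apply: eq_bigr => e _; rewrite hornerM hornerC.
by congr (_ * _); rewrite /mmap1 horner_prod; apply: eq_bigr => i _; rewrite horner_exp.
Qed.

(* Two nonvanishing points are joined by a line, on which the restriction of
   each polynomial is a nonzero univariate polynomial. *)
Lemma generically_and (C : numFieldType) m (Q1 Q2 : ('I_m -> C) -> Prop) :
  generically Q1 -> generically Q2 -> generically (fun v => Q1 v /\ Q2 v).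
Proof.
move=> [p1 [[v1 nz1] h1]] [p2 [[v2 nz2] h2]]; exists (p1 * p2); split; last first.
  by move=> v; rewrite mevalM mulf_eq0 negb_or => /andP[/h1 ? /h2].
pose h i : {poly C} := (v1 i)%:P + (v2 i - v1 i)%:P * 'X.
have h0 : (fun i => (h i).[0]) =1 v1 by move=> i; rewrite hornerD hornerM hornerX !hornerC mulr0 addr0.
have h1' : (fun i => (h i).[1]) =1 v2 by move=> i; rewrite hornerD hornerM hornerX !hornerC mulr1 addrC subrK.
have nzp1 : mmap polyC h p1 != 0.
  by apply: contraNneq nz1 => p0; rewrite -(meval_eq _ h0) -horner_mmap p0 horner0.
have nzp2 : mmap polyC h p2 != 0.
  by apply: contraNneq nz2 => p0; rewrite -(meval_eq _ h1') -horner_mmap p0 horner0.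
have [t] := poly_nonroot (mulf_neq0 nzp1 nzp2).
by rewrite hornerM !horner_mmap -mevalM => nz; exists (fun i => (h i).[t]).
Qed.

Lemma generically_all (C : numFieldType) m (S : eqType) (zs : seq S)
    (Q : S -> ('I_m -> C) -> Prop) :
  (forall z, generically (Q z)) -> generically (fun v => forall z, z \in zs -> Q z v).
Proof.
move=> gen; elim: zs => [|z zs IH].
  by exists 1; split=> //; exists (fun=> 0); rewrite meval1 oner_eq0.
have [p [nzp hp]] := generically_and (gen z) IH; exists p; split=> // v /hp[Qz Qzs] y.
by rewrite inE => /predU1P[->//|/Qzs].
Qed.

(** The entry type is arbitrary so that [v] can be a complex point or the family of indeterminates
    ['X_i]. *)
Definition Umat (T : Type) n k (v : 'I_(n * k + k * n) -> T) : 'M[T]_(n, k) :=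
  \matrix_(i, j) v (lshift (k * n) (mxvec_index i j)).

Definition Wmat (T : Type) n k (v : 'I_(n * k + k * n) -> T) : 'M[T]_(k, n) :=
  \matrix_(i, j) v (rshift (n * k) (mxvec_index i j)).

Lemma Umat_coords (R : realType) n k (U : 'M[R[i]]_(n, k)) W : Umat (coords U W) = U.
Proof. by apply/matrixP => i j; rewrite mxE /coords row_mxEl mxvecE. Qed.

Lemma Wmat_coords (R : realType) n k (U : 'M[R[i]]_(n, k)) W : Wmat (coords U W) = W.
Proof. by apply/matrixP => i j; rewrite mxE /coords row_mxEr mxvecE. Qed.

Lemma map_Umat (C : comNzRingType) n k (v : 'I_(n * k + k * n) -> C) :
  map_mx (meval v) (Umat (fun i => 'X_i)) = Umat v.
Proof. by apply/matrixP => i j; rewrite !mxE mevalXU. Qed.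

Lemma map_Wmat (C : comNzRingType) n k (v : 'I_(n * k + k * n) -> C) :
  map_mx (meval v) (Wmat (fun i => 'X_i)) = Wmat v.
Proof. by apply/matrixP => i j; rewrite !mxE mevalXU. Qed.

Lemma map_mevalC (C : comNzRingType) m p q (v : 'I_m -> C) (K : 'M[C]_(p, q)) :
  map_mx (meval v) (map_mx (@mpolyC m _) K) = K.
Proof. by apply/matrixP => i j; rewrite !mxE mevalC. Qed.

Lemma generic_detW (R : realType) n k (K : 'M[R[i]]_(n, k)) :
  (exists W, W *m K = 1%:M) -> generically (fun v => \det (Wmat v *m K) != 0).
Proof.
move=> [W WK]; exists (\det (Wmat (fun i => 'X_i) *m map_mx (@mpolyC _ _) K)).
have E v : (\det (Wmat (fun i => 'X_i) *m map_mx (@mpolyC _ _) K)).@[v] = \det (Wmat v *m K).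
  by rewrite -det_map_mx map_mxM map_Wmat map_mevalC.
split=> [|v]; last by rewrite E.
by exists (coords 0 W); rewrite E Wmat_coords WK det1 oner_eq0.
Qed.

Lemma generic_detU (R : realType) n k (K : 'M[R[i]]_(k, n)) :
  (exists U, K *m U = 1%:M) -> generically (fun v => \det (K *m Umat v) != 0).
Proof.
move=> [U KU]; exists (\det (map_mx (@mpolyC _ _) K *m Umat (fun i => 'X_i))).
have E v : (\det (map_mx (@mpolyC _ _) K *m Umat (fun i => 'X_i))).@[v] = \det (K *m Umat v).
  by rewrite -det_map_mx map_mxM map_Umat map_mevalC.
split=> [|v]; last by rewrite E.
by exists (coords U 0); rewrite E Umat_coords KU det1 oner_eq0.
Qed.

(** The shape of the Sylvester matrix depends on the degrees, so both leading coefficients must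
    survive the specialisation. *)
Lemma resultant_map (S T : nzRingType) (f : {rmorphism S -> T}) p q :
  f (lead_coef p) != 0 -> f (lead_coef q) != 0 ->
  f (resultant p q) = resultant (map_poly f p) (map_poly f q).
Proof.
move=> nzp nzq; rewrite /resultant /Sylvester_mx !size_map_poly_id0 //.
rewrite -det_map_mx /= map_col_mx; congr (\det (col_mx _ _)).
  by apply: map_lin1_mx => v; rewrite map_poly_rV rmorphM /= map_rVpoly.
by apply: map_lin1_mx => v; rewrite map_poly_rV rmorphM /= map_rVpoly.
Qed.

(** Turns square-freeness at one point into a generic property: the certificate is the top
    coefficient times the resultant of [G] and its derivative. *)
Lemma generic_coprimep_deriv (R : realType) m (G : {poly {mpoly R[i][m]}}) D :
  (size G <= D.+1)%N ->
  (exists v, (forall z, ~~ double_root (map_poly (meval v) G) z) /\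
             (map_poly (meval v) G)`_D != 0) ->
  generically (fun v => (map_poly (meval v) G)`_D != 0 /\
     coprimep (map_poly (meval v) G) (map_poly (meval v) G)^`()).
Proof.
move=> szG [v0 [nd0 nzD0]].
have nzGD : G`_D != 0 by apply: contraNneq nzD0 => G0; rewrite coef_map /= G0 meval0.
have sG : size G = D.+1.
  apply/eqP; rewrite eqn_leq szG ltnNge; apply/negP => sz.
  by rewrite nth_default ?eqxx in nzGD.
have lG : lead_coef G = G`_D by rewrite lead_coefE sG.
(* For [D = 0] the derivative is zero and has no leading coefficient to preserve; the top
   coefficient alone is the certificate. *)
case: D => [|D] in szG nzD0 nzGD sG lG *.
  exists G`_0; split=> [|v nzv]; first by exists v0; rewrite coef_map in nzD0.
  rewrite coef_map /= nzv; split=> //; have /size_poly1P[c nzc EG] : size G == 1%N by rewrite sG.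
  have Ev : map_poly (meval v) G = (c.@[v])%:P by rewrite EG map_polyC.
  by rewrite Ev derivC coprimep0 polyC_eqp1; rewrite EG coefC in nzv.
have ev_char0 v (x : {mpoly R[i][m]}) : x.@[v] != 0 -> (x *+ D.+1).@[v] != 0.
  by rewrite mevalMn mulrn_eq0.
have nzGn : G`_D.+1 *+ D.+1 != 0.
  have := ev_char0 v0 G`_D.+1; rewrite coef_map in nzD0 => /(_ nzD0).
  by apply: contraNneq => ->; rewrite meval0.
have lG' : lead_coef G^`() = G`_D.+1 *+ D.+1 by rewrite lead_coef_deriv sG lG.
have resE v : (G`_D.+1).@[v] != 0 ->
    (resultant G G^`()).@[v] = resultant (map_poly (meval v) G) (map_poly (meval v) G)^`().
  move=> nzv; rewrite deriv_map; apply: resultant_map; rewrite /= ?lG ?lG' //.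
  exact: ev_char0.
have copE (q : {poly R[i]}) : q != 0 -> (resultant q q^`() != 0) = coprimep q q^`().
  move=> nzq; rewrite resultant_eq0 -leqNgt /coprimep eqn_leq.
  by rewrite [X in _ && X]size_poly_gt0 gcdp_eq0 negb_and nzq andbT.
have nzq v : (G`_D.+1).@[v] != 0 -> map_poly (meval v) G != 0.
  by apply: contraNneq => q0; rewrite -coef_map q0 coef0.
have [rs rsE] : exists rs : {mpoly R[i][m]}, forall v, (G`_D.+1).@[v] != 0 ->
    (rs.@[v] != 0) = coprimep (map_poly (meval v) G) (map_poly (meval v) G)^`().
  by exists (resultant G G^`()) => v nzv; rewrite (resE v nzv) (copE _ (nzq v nzv)).
exists (G`_D.+1 * rs); split=> [|v].
  exists v0; rewrite mevalM; rewrite coef_map /= in nzD0.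
  by rewrite mulf_neq0 // rsE //; apply/coprimep_deriv.
by rewrite mevalM mulf_eq0 negb_or coef_map => /andP[nzv]; rewrite rsE.
Qed.

Lemma det_row_affine (T : comNzRingType) k (A A0 A1 : 'M[T]_k) (a : 'I_k) t :
  (forall i j, i != a -> A i j = A0 i j /\ A i j = A1 i j) ->
  (forall j, A a j = (1 - t) * A0 a j + t * A1 a j) ->
  \det A = (1 - t) * \det A0 + t * \det A1.
Proof.
move=> off on; apply: (determinant_multilinear (i0 := a)).
- by apply/rowP => j; rewrite !mxE on.
- by apply/matrixP => i j; rewrite !mxE; have [|->] := off (lift a i) j; rewrite // eq_sym neq_lift.
by apply/matrixP => i j; rewrite !mxE; have [|_ ->] := off (lift a i) j; rewrite // eq_sym neq_lift.
Qed.

(** The entry [(a, b)] of the left factor affects only row [a] of the product, and the determinant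
    is linear in that row. *)
Lemma detW_affine (T : comNzRingType) n k (X : 'M[{poly T}]_(n, k))
    (V : T -> 'M[T]_(k, n)) a b :
  (forall t i j, (i, j) != (a, b) -> V t i j = V 0 i j) -> (forall t, V t a b = t) ->
  forall t, \det (map_mx polyC (V t) *m X) =
    (1 - t) *: \det (map_mx polyC (V 0) *m X) + t *: \det (map_mx polyC (V 1) *m X).
Proof.
move=> off on t; rewrite -!mul_polyC rmorphB /=.
apply: (det_row_affine (a := a)) => [i j nia|j]; rewrite !mxE.
  have E s : \sum_l map_mx polyC (V s) i l * X l j = \sum_l map_mx polyC (V 0) i l * X l j.
    by apply: eq_bigr => l _; rewrite !mxE off // xpair_eqE (negbTE nia).
  by rewrite !E.
rewrite !mulr_sumr -big_split; apply: eq_bigr => l _; rewrite /= !mxE !mulrA -mulrDl; congr (_ * _).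
have [->|nl] := eqVneq l b; first by rewrite !on mulr0 add0r mulr1.
have nab : (a, l) != (a, b) by rewrite xpair_eqE eqxx.
by rewrite (off t) // (off 1) // -mulrDl subrK mul1r.
Qed.

(* Each coordinate of [(U, W)] occurs in a single entry of a single factor, so
   the product is affine in it. *)
Lemma generic_squarefree (R : realType) n k (X Z : 'M[{poly R[i]}]_(n, k))
    (e f : 'I_k -> nat) :
  (forall i j, (size (X i j) <= (e j).+1)%N) ->
  (forall i j, (size (Z i j) <= (f j).+1)%N) ->
  (exists W, W *m \matrix_(i, j) (X i j)`_(e j) = 1%:M) ->
  (exists W, W *m \matrix_(i, j) (Z i j)`_(f j) = 1%:M) ->
  (forall z, exists W, W *m mxeval X z = 1%:M) ->
  (forall z, exists W, W *m mxeval Z z = 1%:M) ->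
  generically (fun v =>
    let p := \det (map_mx polyC (Wmat v) *m X) in
    let q := \det (map_mx polyC (Umat v)^T *m Z) in
    [/\ size p = (\sum_j e j).+1, size q = (\sum_j f j).+1 & coprimep (p * q) (p * q)^`()]).
Proof.
move=> szX szZ [WX EWX] [WZ EWZ] fullX fullZ.
pose P v : {poly R[i]} := \det (map_mx polyC (Wmat v) *m X).
pose Q v : {poly R[i]} := \det (map_mx polyC (Umat v)^T *m Z).
pose D := (\sum_j e j + \sum_j f j)%N.
(* [G] is the product of the two determinants with indeterminates as entries of [U] and [W]; [evG]
   specialises it. *)
pose lift : {poly R[i]} -> {poly {mpoly R[i][n * k + k * n]}} := map_poly (@mpolyC (n * k + k * n) R[i]).
pose G : {poly {mpoly R[i][n * k + k * n]}} := \det (map_mx polyC (Wmat (fun i => 'X_i)) *m map_mx lift X) *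
          \det (map_mx polyC (Umat (fun i => 'X_i))^T *m map_mx lift Z).
have szlift (Y : 'M[{poly R[i]}]_(n, k)) h : (forall i j, (size (Y i j) <= (h j).+1)%N) ->
    forall i j, (size (map_mx lift Y i j) <= (h j).+1)%N.
  by move=> szY i j; rewrite mxE (leq_trans (size_poly _ _)).
have [szP _] := coef_det_mull (Wmat (fun i => 'X_i)) (szlift X e szX).
have [szQ _] := coef_det_mull (Umat (fun i => 'X_i))^T (szlift Z f szZ).
have [szG _] := coefM_top szP szQ.
have evlift v (Y : 'M[{poly R[i]}]_(n, k)) :
    map_mx (map_poly (meval v)) (map_mx lift Y) = Y.
  apply/matrixP => i j; rewrite !mxE -map_poly_comp map_poly_id // => c _ /=.
  by rewrite mevalC.
have evG v : map_poly (meval v) G = P v * Q v.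
  rewrite rmorphM /= -!det_map_mx !map_mxM /= !evlift.
  have EW : map_mx (map_poly (meval v)) (map_mx polyC (Wmat (fun i => 'X_i))) =
      map_mx polyC (Wmat v).
    by apply/matrixP => i j; rewrite !mxE map_polyC /= mevalXU.
  have EU : map_mx (map_poly (meval v)) (map_mx polyC (Umat (fun i => 'X_i))^T) =
      map_mx polyC (Umat v)^T.
    by apply/matrixP => i j; rewrite !mxE map_polyC /= mevalXU.
  by rewrite EW EU.
have topPQ v : (size (P v) <= (\sum_j e j).+1)%N /\ (size (Q v) <= (\sum_j f j).+1)%N.
  have [sP _] := coef_det_mull (Wmat v) szX.
  by have [sQ _] := coef_det_mull (Umat v)^T szZ.
have topD v : (P v * Q v)`_D = (P v)`_(\sum_j e j) * (Q v)`_(\sum_j f j).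
  by have [sP sQ] := topPQ v; have [] := coefM_top sP sQ.
have affine w c t : P [eta w with c |-> t] * Q [eta w with c |-> t] =
    (1 - t) *: (P [eta w with c |-> 0] * Q [eta w with c |-> 0]) +
    t *: (P [eta w with c |-> 1] * Q [eta w with c |-> 1]).
  case: (split_ordP c) => c' ->; case/mxvec_indexP: c' => a b.
    have WE s s' : Wmat [eta w with lshift (k * n) (mxvec_index a b) |-> s] =
                   Wmat [eta w with lshift (k * n) (mxvec_index a b) |-> s'].
      by apply/matrixP => i j; rewrite !mxE /= eq_rlshift.
    have PE s : P [eta w with lshift (k * n) (mxvec_index a b) |-> s] =
                P [eta w with lshift (k * n) (mxvec_index a b) |-> t].
      by rewrite /P (WE s t).
    rewrite (PE 0) (PE 1) !scalerAr -mulrDr; congr (_ * _).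
    rewrite /Q.
    (* [U] enters transposed, so its coordinate [(a, b)] is the entry [(b, a)] of the left
       factor. *)
    apply: (@detW_affine _ _ _ Z (fun s => (Umat [eta w with lshift (k * n) (mxvec_index a b) |-> s])^T)
      b a) => [s i j|s]; rewrite !mxE /= ?eqxx //.
    rewrite eq_lshift xpair_eqE => nij; case: eqP => // /cast_ord_inj /enum_rank_inj [ej ei].
    by rewrite ej ei !eqxx in nij.
  have UE s s' : Umat [eta w with rshift (n * k) (mxvec_index a b) |-> s] =
                 Umat [eta w with rshift (n * k) (mxvec_index a b) |-> s'].
    by apply/matrixP => i j; rewrite !mxE /= eq_lrshift.
  have QE s : Q [eta w with rshift (n * k) (mxvec_index a b) |-> s] =
              Q [eta w with rshift (n * k) (mxvec_index a b) |-> t].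
    by rewrite /Q (UE s t).
  rewrite (QE 0) (QE 1) !scalerAl -mulrDl; congr (_ * _).
  rewrite /P.
  apply: (@detW_affine _ _ _ X (fun s => Wmat [eta w with rshift (n * k) (mxvec_index a b) |-> s])
      a b) => [s i j|s]; rewrite !mxE /= ?eqxx //.
  rewrite eq_rshift xpair_eqE => nij; case: eqP => // /cast_ord_inj /enum_rank_inj [ei ej].
  by rewrite ej ei !eqxx in nij.
have evP W U z : (P (coords U W)).[z] = \det (W *m mxeval X z).
  rewrite /P Wmat_coords -mxeval_det mxevalM; congr (\det (_ *m _)).
  by apply/matrixP => i j; rewrite !mxE hornerC.
have evQ W U z : (Q (coords U W)).[z] = \det (U^T *m mxeval Z z).
  rewrite /Q Umat_coords -mxeval_det mxevalM; congr (\det (_ *m _)).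
  by apply/matrixP => i j; rewrite !mxE hornerC.
have [|||v0 [nd0 lead0]] := @multiaffine_no_double_root R[i] _ (fun v => P v * Q v) D.
- exact: affine.
(* The witness may depend on [z]: left inverses at [z] make both determinants 1 there, so [z] is not
   even a root. *)
- move=> z; have [W EW] := fullX z; have [U EU] := fullZ z.
  exists (coords U^T W); rewrite /double_root /root hornerM evP evQ trmxK EW EU !det1.
  by rewrite mulr1 oner_eq0.
- exists (coords WZ^T WX); rewrite topD.
  have [_ ->] := coef_det_mull (Wmat (coords WZ^T WX)) szX.
  have [_ ->] := coef_det_mull (Umat (coords WZ^T WX))^T szZ.
  by rewrite Wmat_coords Umat_coords trmxK EWX EWZ !det1 mulr1 oner_eq0.
have [|pol [nzpol hpol]] := generic_coprimep_deriv szG.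
  by exists v0; rewrite evG.
exists pol; split=> // v /hpol; rewrite evG -/D topD mulf_eq0 negb_or => -[/andP[nzP nzQ] cop].
have [sP sQ] := topPQ v.
have szE (p : {poly R[i]}) a : (size p <= a.+1)%N -> p`_a != 0 -> size p = a.+1.
  move=> sp nzp; apply/eqP; rewrite eqn_leq sp ltnNge; apply/negP => sz.
  by rewrite nth_default ?eqxx in nzp.
by split=> //; apply: szE.
Qed.

(** * Reversal *)

Definition rev_poly (C : nzRingType) D (p : {poly C}) : {poly C} :=
  \poly_(l < D.+1) p`_(D - l).

Lemma horner_rev_poly (C : fieldType) D (p : {poly C}) z :
  (size p <= D.+1)%N -> z != 0 -> (rev_poly D p).[z] = z ^+ D * p.[z^-1].
Proof.
move=> sz nz; rewrite horner_poly (horner_coef_wide _ sz) mulr_sumr.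
rewrite (reindex_inj rev_ord_inj) /=; apply: eq_bigr => l _.
have lD : (l <= D)%N by rewrite -ltnS.
rewrite subSS subKn // mulrCA; congr (_ * _).
by rewrite exprVn expfB_cond ?(negbTE nz).
Qed.

Lemma rev_poly_factor (C : nzRingType) D (p : {poly C}) :
  ((size p).-1 <= D)%N -> rev_poly D p = 'X^(D - (size p).-1) * rev_poly (size p).-1 p.
Proof.
set m := (size p).-1 => mD; apply/polyP => l; rewrite coefXnM !coef_poly.
case: (ltnP l (D - m)) => [lt|ge].
  rewrite ifT; last by rewrite ltnS (leq_trans (ltnW lt)) // leq_subr.
  by rewrite nth_default // (leq_trans (leqSpred _)) // -/m ltn_subRL addnC -ltn_subRL.
rewrite ltnS [in RHS]ltnS leq_subLR subnK //; case: ifP => // lD; congr (p`_ _); lia.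
Qed.

(** Reversal at the exact degree has the leading coefficient as value at 0; the excess of the grade
    [D] over the degree becomes the order of vanishing at 0. *)
Lemma mup_rev_poly (C : fieldType) D (p : {poly C}) : p != 0 -> (size p <= D.+1)%N ->
  rev_poly D p != 0 /\ ((size p).-1 + mup 0 (rev_poly D p))%N = D.
Proof.
move=> nzp sz; set m := (size p).-1.
have mD : (m <= D)%N by rewrite -ltnS prednK ?size_poly_gt0.
have nr : ~~ root (rev_poly m p) 0.
  by rewrite /root horner_coef0 coef_poly subn0 -lead_coefE lead_coef_eq0.
have nz : rev_poly m p != 0 by apply: contraNneq nr => ->; rewrite root0.
rewrite rev_poly_factor // -/m mupMl // -['X]subr0 -polyC0 mup_XsubCX eqxx subnKC //.
by split=> //; rewrite mulf_neq0 // expf_neq0 // polyXsubC_eq0.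
Qed.

Lemma mxpolE (R : realType) d m n (A : nat -> 'M[R[i]]_(m, n)) z :
  mxeval (mxpol d A) z = \sum_(l < d.+1) z ^+ l *: A l.
Proof.
apply/matrixP => i j; rewrite !mxE summxE horner_poly.
by apply: eq_bigr => l _; rewrite !mxE mulrC.
Qed.

Lemma mxeval_rev (R : realType) d m n (A : nat -> 'M[R[i]]_(m, n)) z : z != 0 ->
  mxeval (mxpol d (mxrev d A)) z = z ^+ d *: mxeval (mxpol d A) z^-1.
Proof.
move=> nz; rewrite !mxpolE scaler_sumr (reindex_inj rev_ord_inj) /=.
apply: eq_bigr => l _; have ld : (l <= d)%N by rewrite -ltnS.
by rewrite /mxrev subSS subKn // scalerA exprVn expfB_cond ?(negbTE nz).
Qed.

(** The determinant of the reversal is the reversal of the determinant at grade [n * d], so finite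
    and infinite eigenvalues together number [n * d]. *)
Lemma det_mxrev (R : realType) d n (A : nat -> 'M[R[i]]_n) :
  \det (mxpol d A) != 0 ->
  \det (mxpol d (mxrev d A)) != 0 /\
  ((size (\det (mxpol d A))).-1 + mup 0%R (\det (mxpol d (mxrev d A))))%N = (n * d)%N.
Proof.
move=> nzf; have [|szf _] := @coef_det_top _ _ (mxpol d A) (fun=> d).
  by move=> i j; rewrite mxE size_poly.
rewrite sum_nat_const card_ord in szf.
suff -> : \det (mxpol d (mxrev d A)) = rev_poly (n * d) (\det (mxpol d A)).
  exact: mup_rev_poly.
apply/eqP; rewrite -subr_eq0; apply/negPn/negP => nzd.
have [z] := poly_nonroot (mulf_neq0 (negbT (polyX_eq0 R[i])) nzd).
rewrite hornerM hornerX mulf_eq0 negb_or => /andP[nz].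
rewrite hornerD hornerN -mxeval_det mxeval_rev // detZ mxeval_det.
by rewrite horner_rev_poly // -exprM mulnC subrr eqxx.
Qed.

(** * Normal rank and its invariance under reversal *)

Lemma nrank_exists (R : realType) m n (P : 'M[{poly R[i]}]_(m, n)) : exists r, is_nrank P r.
Proof.
pose Q r := `[< exists z, \rank (mxeval P z) = r >].
have ex : exists r, Q r by exists (\rank (mxeval P 0)); apply/asboolP; exists 0.
have ub r : Q r -> (r <= m)%N by move=> /asboolP[z <-]; apply: rank_leq_row.
case: (ex_maxnP ex ub) => r /asboolP[z rz] maxr; exists r; split; first by exists z.
by move=> y; apply: maxr; apply/asboolP; exists y.
Qed.

Lemma nrank_generic (R : realType) n (P : 'M[{poly R[i]}]_n) r :
  is_nrank P r -> exists rs : seq R[i], forall z, z \notin rs -> \rank (mxeval P z) = r.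
Proof.
move=> nr; have rn : (r <= n)%N by case: nr => [[z <-] _]; apply: rank_leq_row.
have [k En] : exists k, n = (r + k)%N by exists (n - r)%N; rewrite subnKC.
subst n; have [Y [X [g sp]]] := null_splitting_exists nr.
have nzg : g != 0 by case: sp => E [G [D []]].
have [rs Ers _] := roots_seq nzg; exists rs => z nz; apply/eqP.
rewrite eqn_leq (nr.2 z) leqNgt (null_splitting_rank z sp) -dvdp_XsubCl XsubC_dvd //.
by rewrite -Ers -has_count has_pred1.
Qed.

Lemma nrank_rev (R : realType) d n (A : nat -> 'M[R[i]]_n) r :
  is_nrank (mxpol d A) r -> is_nrank (mxpol d (mxrev d A)) r.
Proof.
move=> nr; have [s ns] := nrank_exists (mxpol d (mxrev d A)).
have [rs Ers] := nrank_generic nr; have [ss Ess] := nrank_generic ns.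
have [z] := fresh_point (0 :: ss ++ [seq x^-1 | x <- rs]).
rewrite inE mem_cat !negb_or => /and3P[nz /Ess Es nrz].
suff -> : r = s by [].
rewrite -Es mxeval_rev // mxrank_scale_nz ?expf_neq0 // Ers //.
by apply: contra nrz => zrs; rewrite -[z]invrK map_f.
Qed.

(** * Eigenvectors of the perturbed matrix *)

Lemma ctr_mul (R : realType) m n p (A : 'M[R[i]]_(m, n)) (B : 'M_(n, p)) :
  ctr (A *m B) = ctr B *m ctr A.
Proof. by rewrite /ctr map_mxM trmx_mul. Qed.

Lemma ctrK (R : realType) m n (A : 'M[R[i]]_(m, n)) : ctr (ctr A) = A.
Proof. by apply/matrixP => i j; rewrite !mxE conjcK. Qed.

Lemma ctr_eq0 (R : realType) m n (A : 'M[R[i]]_(m, n)) : (ctr A == 0) = (A == 0).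
Proof.
have ctr0 a b : ctr (0 : 'M[R[i]]_(a, b)) = 0 by rewrite /ctr map_mx0 trmx0.
by apply/eqP/eqP => [e|->]; [rewrite -[A]ctrK e|]; rewrite ctr0.
Qed.

(** Multiplying by [Y] at [z] kills [P] and leaves an invertible matrix applied to [W *m x]. *)
Lemma perturbed_ker_small (R : realType) r k p (P : 'M[{poly R[i]}]_(r + k)) Y X g z
    (U : 'M_(r + k, k)) (q : 'M_k) (W : 'M_(k, r + k)) (x : 'M_(r + k, p)) :
  null_splitting P Y X g -> \det (mxeval Y z *m U) != 0 -> \det q != 0 ->
  (mxeval P z + U *m q *m W) *m x = 0 -> W *m x = 0.
Proof.
move=> /null_splitting_tr/null_splitting_ker/(congr1 trmx); rewrite trmx_mul !trmxK trmx0.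
move=> YP nzU nzq /(congr1 (mulmx (mxeval Y z))).
rewrite mulmx0 mulmxA mulmxDr -mxevalM YP /mxeval (map_mx0 (horner_eval z)) add0r -/(mxeval Y z).
rewrite !mulmxA -mulmxA => e.
have uYUq : mxeval Y z *m U *m q \in unitmx by rewrite unitmxE unitfE det_mulmx mulf_neq0.
by rewrite -(mulKmx uYUq (W *m x)) e mulmx0.
Qed.

(** If [W *m x = 0], then [x] is a null vector of [P] at [z], hence a combination of the columns of
    [X] off the roots of [g]; invertibility of [W X] there forces [x = 0]. *)
Lemma perturbed_ker_large (R : realType) r k (P : 'M[{poly R[i]}]_(r + k)) Y X g z
    (U : 'M_(r + k, k)) (q : 'M_k) (W : 'M_(k, r + k)) (x : 'cV_(r + k)) :
  null_splitting P Y X g -> \det (W *m mxeval X z) != 0 -> ~~ root g z -> x != 0 ->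
  (mxeval P z + U *m q *m W) *m x = 0 -> W *m x != 0.
Proof.
move=> sp nzW nrg nzx; apply: contra_eqN => /eqP Wx.
rewrite mulmxDl -!mulmxA Wx !mulmx0 addr0; apply: contraNneq nzx => Px.
have [c xE] := null_splitting_ker_eval sp nrg Px.
have uWX : W *m mxeval X z \in unitmx by rewrite unitmxE unitfE.
have c0 : c = 0 by rewrite -(mulKmx uWX c) -mulmxA -xE Wx mulmx0.
by rewrite xE c0 mulmx0.
Qed.

Lemma perturbed_coker_small (R : realType) r k p (P : 'M[{poly R[i]}]_(r + k)) Y X g z
    (U : 'M_(r + k, k)) (q : 'M_k) (W : 'M_(k, r + k)) (y : 'M_(p, r + k)) :
  null_splitting P Y X g -> \det (W *m mxeval X z) != 0 -> \det q != 0 ->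
  y *m (mxeval P z + U *m q *m W) = 0 -> y *m U = 0.
Proof.
move=> /null_splitting_tr sp nzW nzq /(congr1 trmx) yP.
apply: trmx_inj; rewrite trmx_mul trmx0.
apply: (perturbed_ker_small (z := z) (U := W^T) (q := q^T) sp).
- by rewrite /mxeval -map_trmx -trmx_mul det_tr.
- by rewrite det_tr.
by move: yP; rewrite trmx_mul trmx0 linearD /= !trmx_mul /mxeval -map_trmx !mulmxA.
Qed.

Lemma perturbed_coker_large (R : realType) r k (P : 'M[{poly R[i]}]_(r + k)) Y X g z
    (U : 'M_(r + k, k)) (q : 'M_k) (W : 'M_(k, r + k)) (y : 'rV_(r + k)) :
  null_splitting P Y X g -> \det (mxeval Y z *m U) != 0 -> ~~ root g z -> y != 0 ->
  y *m (mxeval P z + U *m q *m W) = 0 -> y *m U != 0.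
Proof.
move=> /null_splitting_tr sp nzU nrg nzy /(congr1 trmx) yP.
rewrite -trmx_eq0 trmx_mul.
apply: (perturbed_ker_large (z := z) (U := W^T) (q := q^T) sp) => //.
- by rewrite /mxeval -map_trmx -trmx_mul det_tr.
- by rewrite trmx_eq0.
by move: yP; rewrite trmx_mul trmx0 linearD /= !trmx_mul /mxeval -map_trmx !mulmxA.
Qed.

(** * The perturbed polynomial and lists of extended eigenvalues *)

Definition perturb (R : realType) n k (A : nat -> 'M[R[i]]_n) (B : nat -> 'M[R[i]]_k)
    (U : 'M[R[i]]_(n, k)) (W : 'M[R[i]]_(k, n)) (tau : R[i]) : nat -> 'M[R[i]]_n :=
  fun l => A l + tau *: (U *m B l *m W).

(** The perturbation acts coefficientwise, so it commutes with reversal; [tau] is absorbed into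
    [U]. *)
Lemma ext_mxpol_perturb (R : realType) d n k (A : nat -> 'M[R[i]]_n) (B : nat -> 'M[R[i]]_k)
    U W tau z :
  ext_mxpol d (perturb A B U W tau) z =
  ext_mxpol d A z + map_mx polyC (tau *: U) *m ext_mxpol d B z *m map_mx polyC W.
Proof.
have E A' B' : mxpol d (perturb A' B' U W tau) =
    mxpol d A' + map_mx polyC (tau *: U) *m mxpol d B' *m map_mx polyC W.
  apply/matrixP => i j; apply/polyP => l.
  rewrite mxE [in RHS]mxE coefD [in RHS]mxE !coef_poly.
  have -> : ((map_mx polyC (tau *: U) *m mxpol d B' *m map_mx polyC W) i j)`_l =
      if (l < d.+1)%N then (tau *: (U *m B' l *m W)) i j else 0.
    rewrite mxE coef_sum; case: ifP => lt.
      rewrite [RHS]mxE [X in _ = tau * X]mxE mulr_sumr; apply: eq_bigr => a _.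
      rewrite [map_mx polyC W a j]mxE coefMC mulrA; congr (_ * _).
      rewrite mxE coef_sum [X in _ = tau * X]mxE mulr_sumr; apply: eq_bigr => b _.
      by rewrite !mxE coefCM coef_poly lt mulrA.
    rewrite big1 // => a _; rewrite [map_mx polyC W a j]mxE coefMC mxE coef_sum.
    by rewrite big1 ?mul0r // => b _; rewrite !mxE coefCM coef_poly lt mulr0.
  by case: ifP; rewrite ?addr0 // !mxE.
by case: z => [z|]; rewrite -E.
Qed.

Lemma mxeval_ext_perturb (R : realType) d n k (A : nat -> 'M[R[i]]_n)
    (B : nat -> 'M[R[i]]_k) U W tau z t :
  mxeval (ext_mxpol d (perturb A B U W tau) z) t =
  mxeval (ext_mxpol d A z) t + (tau *: U) *m mxeval (ext_mxpol d B z) t *m W.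
Proof.
have evC m p (K : 'M[R[i]]_(m, p)) : mxeval (map_mx polyC K) t = K.
  by apply/matrixP => i j; rewrite !mxE hornerC.
by rewrite ext_mxpol_perturb mxevalD !mxevalM !evC.
Qed.

(** Lists with repetition serve as multisets whose [count_mem] is the multiplicity, so the groups of
    eigenvalues can be concatenated. *)
Lemma ext_roots (R : realType) (f0 f1 : {poly R[i]}) : f0 != 0 ->
  exists2 s : seq (option R[i]),
    forall z, count_mem z s = mup (ext_pt z) (if z is Some _ then f0 else f1)
    & size s = ((size f0).-1 + mup 0%R f1)%N.
Proof.
case/roots_seq => rs Ers szrs; exists (map Some rs ++ nseq (mup 0 f1) None).
  case=> [z|]; rewrite count_cat count_map count_nseq /=.
    by rewrite mul0n addn0 -Ers; apply: eq_count.
  by rewrite mul1n (eq_count (a2 := pred0)) ?count_pred0.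
by rewrite size_cat size_map size_nseq szrs.
Qed.

Lemma mem_roots (R : realType) (s : seq (option R[i])) z (f : {poly R[i]}) :
  f != 0 -> count_mem z s = mup (ext_pt z) f -> (z \in s) = root f (ext_pt z).
Proof. by move=> nzf E; rewrite -has_pred1 has_count E -XsubC_dvd // dvdp_XsubCl. Qed.

Theorem theorem3p2 (R : realType) (n k d : nat) (A : nat -> 'M[R[i]]_n)
    (eps eta : 'I_k -> nat) (B : nat -> 'M[R[i]]_k) :
  A d != 0 ->
  (k <= n)%N ->
  singular (mxpol d A) ->
  is_nrank (mxpol d A) (n - k) ->
  right_minimal_indices (mxpol d A) eps ->
  (forall i j : 'I_k, (i <= j)%N -> (eps i <= eps j)%N) ->
  left_minimal_indices (mxpol d A) eta ->
  (forall i j : 'I_k, (i <= j)%N -> (eta i <= eta j)%N) ->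
  (forall z, peigenvalue d A z -> semisimple_eig d A z) ->
  regular (mxpol d B) ->
  (forall z, peigenvalue d B z -> alg_mult d B z 1) ->
  (forall z, peigenvalue d B z -> ~ peigenvalue d A z) ->
  let M := (\sum_i eps i)%N in
  let N := (\sum_i eta i)%N in
  exists Om : 'M[R[i]]_(n, k) -> 'M[R[i]]_(k, n) -> Prop,
    generic_set Om /\
    forall (U : 'M[R[i]]_(n, k)) (W : 'M[R[i]]_(k, n)), Om U W ->
    exists sa sb sc sd : seq (option R[i]),
      size (sa ++ sb ++ sc ++ sd) = (n * d)%N /\
      forall tau : R[i], 0 < tau ->
      let At := fun l => A l + tau *: (U *m B l *m W) in
      regular (mxpol d At) /\
      (forall z, alg_mult d At z (count_mem z (sa ++ sb ++ sc ++ sd))) /\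
      (* (a) true eigenvalues *)
      ((forall z, z \in sa <-> peigenvalue d A z) /\
       size sa = ((n - k) * d - M - N)%N /\
       (forall z, z \in sa -> peigenvalue d At z /\
          (forall x, right_eigvec d At z x -> W *m x = 0) /\
          (forall y, left_eigvec d At z y -> ctr U *m y = 0))) /\
      (* (b) right random eigenvalues *)
      (size sb = M /\ uniq sb /\
       (forall z, z \in sb -> alg_mult d At z 1 /\ z \notin sa /\ ~ peigenvalue d B z /\
          (forall x, right_eigvec d At z x -> W *m x = 0) /\
          (forall y, left_eigvec d At z y -> ctr U *m y != 0))) /\
      (* (c) left random eigenvalues *)
      (size sc = N /\ uniq sc /\
       (forall z, z \in sc -> alg_mult d At z 1 /\ z \notin sa /\ z \notin sb /\
          ~ peigenvalue d B z /\
          (forall x, right_eigvec d At z x -> W *m x != 0) /\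
          (forall y, left_eigvec d At z y -> ctr U *m y = 0))) /\
      (* (d) prescribed eigenvalues *)
      ((forall z, z \in sd <-> peigenvalue d B z) /\
       size sd = (k * d)%N /\
       (forall z, z \in sd -> peigenvalue d At z /\
          (forall x, right_eigvec d At z x -> W *m x != 0) /\
          (forall y, left_eigvec d At z y -> ctr U *m y != 0))).
Proof.
(* Size bookkeeping for [sizes]: [a] and [b] are the sizes of the factors from P and Q, [c] and [e]
   their multiplicities at infinity, [m] and [l] the degrees M and N. *)
have degrees a b c e m l : (0 < a)%N -> (0 < b)%N -> (a.-1 + c + m + l + (b.-1 + e))%N =
    (((a + l.+1).-1 + b).-1 + m.+1).-2 + (c + (0 + (0 + e))) :> nat by lia.
move=> _ kn _ nrA [X [mX vX]] _ [Y [mY vY]] _ _ regB _ disj M N.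
have [r En] : exists r, n = (r + k)%N by exists (n - k)%N; rewrite subnK.
subst n; rewrite addnK in nrA *.
have [g sp] := null_splitting_minimal nrA mX mY.
have nrA' := nrank_rev nrA; have [Y' [X' [g' sp']]] := null_splitting_exists nrA'.
(* All finite points share the minimal bases; infinity uses an unrelated splitting of the
   reversal. *)
pose YY (z : option R[i]) := if z is Some _ then Y^T else Y'.
pose XX (z : option R[i]) := if z is Some _ then X else X'.
pose gg (z : option R[i]) := if z is Some _ then g else g'.
have spz z : null_splitting (ext_mxpol d A z) (YY z) (XX z) (gg z) by case: z.
have nzg z : gg z != 0 by case: (spz z) => ? [? [? []]].
have nrAz z : is_nrank (ext_mxpol d A z) r by case: z.
pose bb z := \det (ext_mxpol d B z).
have [nzB' szB] := det_mxrev regB.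
have nzb z : bb z != 0 by case: z.
have eigA z : peigenvalue d A z <-> root (gg z) (ext_pt z).
  by rewrite /peigenvalue (fin_eigenvalueP _ (nrAz z)) (null_splitting_rank _ (spz z)).
have eigB z : peigenvalue d B z <-> root (bb z) (ext_pt z).
  exact: fin_eigenvalue_regular (nzb z).
have disjAB z : root (gg z) (ext_pt z) -> ~~ root (bb z) (ext_pt z).
  by move=> /eigA rA; apply/negP => /eigB/disj; apply.
(* [Some 0] stands for any finite point, as [gg] and [bb] are constant on those. *)
have [sa ca sza] := ext_roots (gg None) (nzg (Some 0)).
have [sd cd szd] := ext_roots (bb None) (nzb (Some 0)).
have {}ca z : count_mem z sa = mup (ext_pt z) (gg z) by rewrite ca; case: z.
have {}cd z : count_mem z sd = mup (ext_pt z) (bb z) by rewrite cd; case: z.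
have ma z : (z \in sa) = root (gg z) (ext_pt z) := mem_roots (nzg z) (ca z).
have md z : (z \in sd) = root (bb z) (ext_pt z) := mem_roots (nzb z) (cd z).
have linvY z t : exists U, mxeval (YY z) t *m U = 1%:M.
  have [V VY] := null_splitting_linv t (null_splitting_tr (spz z)); exists V^T.
  by apply: trmx_inj; rewrite trmx_mul trmxK trmx1 -VY /mxeval map_trmx.
pose good v z := \det (Wmat v *m mxeval (XX z) (ext_pt z)) != 0 /\
                 \det (mxeval (YY z) (ext_pt z) *m Umat v) != 0.
have gen1 : generically (fun v => forall z, z \in None :: sa ++ sd -> good v z).
  apply: (@generically_all _ _ _ _ (fun z v => good v z)) => z.
  apply: generically_and; last exact/generic_detU/linvY.
  exact/generic_detW/(null_splitting_linv _ (spz z)).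
have lead (Z : 'M[{poly R[i]}]_(r + k, k)) e : (forall j, vdeg Z j = e j) ->
    lead_mx Z = \matrix_(i, j) (Z i j)`_(e j).
  by move=> vZ; apply/matrixP => i j; rewrite !mxE vZ.
have gen2 := generic_squarefree (X := X) (Z := Y) (e := eps) (f := eta).
have {gen2} [|||||| pol [nzpol hpol]] := generically_and gen1 (gen2 _ _ _ _ _ _).
- by move=> i j; rewrite -vX size_le_vdeg.
- by move=> i j; rewrite -vY size_le_vdeg.
- by rewrite -(lead _ _ vX); apply: left_inverse_of_inj => c; apply: minimal_basis_lead_inj mX.
- by rewrite -(lead _ _ vY); apply: left_inverse_of_inj => c; apply: minimal_basis_lead_inj mY.
- by move=> z; apply: left_inverse_of_inj => c; apply: minimal_basis_eval_inj mX.
- by move=> z; apply: left_inverse_of_inj => c; apply: minimal_basis_eval_inj mY.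
exists (fun U W => pol.@[coords U W] != 0); split.
  exists (fun f => f = pol); split; first by have [v nz] := nzpol; exists v, pol.
  by move=> U W /negP; rewrite negbK => /eqP pol0 _ ->.
move=> U W /hpol[]; rewrite /good Umat_coords Wmat_coords => good0 /=.
set p := \det _; set q := \det _; rewrite -/M -/N => -[szp szq cop].
pose pp z := \det (map_mx polyC W *m XX z).
pose qq z := \det (YY z *m map_mx polyC U).
have evC m l (K : 'M[R[i]]_(m, l)) z : mxeval (map_mx polyC K) z = K.
  by apply/matrixP => i j; rewrite !mxE hornerC.
have evp z t : \det (W *m mxeval (XX z) t) = (pp z).[t].
  by rewrite /pp -mxeval_det mxevalM evC.
have evq z t : \det (mxeval (YY z) t *m U) = (qq z).[t].
  by rewrite /qq -mxeval_det mxevalM evC.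
have evb z t : \det (mxeval (ext_mxpol d B z) t) = (bb z).[t] := mxeval_det _ _.
have qqE t : qq (Some t) = q.
  by rewrite /q /qq /= -det_tr trmx_mul trmxK map_trmx.
have good1 z : z \in None :: sa ++ sd -> ~~ root (pp z) (ext_pt z) /\ ~~ root (qq z) (ext_pt z).
  by move/good0; rewrite evp evq.
have ppE t : pp (Some t) = p by [].
have szd' : size sd = (k * d)%N by rewrite szd szB.
pose At tau := perturb A B U W tau.
(* [tau] enters only through the nonzero constant, so the roots and their multiplicities do not
   depend on it. *)
have detAt tau z : tau != 0 -> exists2 c, c != 0 &
    \det (ext_mxpol d (At tau) z) = c *: (gg z * qq z * bb z * pp z).
  move=> nzt; have [c nzc Ec] := null_splitting_det (spz z).
  exists (c * tau ^+ k); first by rewrite mulf_neq0 // expf_neq0.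
  rewrite ext_mxpol_perturb Ec map_mxZ -scalemxAr detZ -rmorphXn mul_polyC.
  by rewrite -scalerAr -!scalerAl scalerA.
clearbody gg pp qq bb p q.
have nzp : p != 0 by rewrite -size_poly_eq0 szp.
have nzq : q != 0 by rewrite -size_poly_eq0 szq.
have [npN nqN] := good1 None (mem_head _ _).
have nzpp z : pp z != 0.
  by case: z => [t|]; [rewrite ppE|apply: contraNneq npN => ->; rewrite root0].
have nzqq z : qq z != 0.
  by case: z => [t|]; [rewrite qqE|apply: contraNneq nqN => ->; rewrite root0].
have [sb cb szb] := ext_roots (pp None) (nzpp (Some 0)).
have [sc cc szc] := ext_roots (qq None) (nzqq (Some 0)).
have {}cb z : count_mem z sb = mup (ext_pt z) (pp z) by rewrite cb; case: z => // t; rewrite !ppE.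
have {}cc z : count_mem z sc = mup (ext_pt z) (qq z) by rewrite cc; case: z => // t; rewrite !qqE.
have mb z : (z \in sb) = root (pp z) (ext_pt z) := mem_roots (nzpp z) (cb z).
have mc z : (z \in sc) = root (qq z) (ext_pt z) := mem_roots (nzqq z) (cc z).
have {}szb : size sb = M by rewrite szb (mupNroot npN) addn0 ppE szp.
have {}szc : size sc = N by rewrite szc (mupNroot nqN) addn0 qqE szq.
(* Square-freeness of [p * q] at finite points and nonvanishing at infinity; this yields both the
   simplicity and the disjointness of groups (b) and (c). *)
have simple z : (mup (ext_pt z) (pp z) + mup (ext_pt z) (qq z) <= 1)%N.
  case: z => [t|]; last by rewrite !mupNroot.
  rewrite ppE qqE -mupM //; apply: mup_le1; first by rewrite mulf_neq0.
  by move/coprimep_deriv: cop; apply.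
have nzAt tau z : tau != 0 -> \det (ext_mxpol d (At tau) z) != 0.
  move=> /(detAt tau z)[c nzc ->]; rewrite scaler_eq0 negb_or nzc.
  by rewrite !mulf_neq0.
have mupAt tau z : tau != 0 -> mup (ext_pt z) (\det (ext_mxpol d (At tau) z)) =
    count_mem z (sa ++ sb ++ sc ++ sd).
  move=> /(detAt tau z)[c nzc ->]; rewrite !count_cat ca cb cc cd.
  rewrite -mul_polyC mupMr ?rootC // !mupM ?mulf_neq0 //.
  by rewrite -!addnA; congr (_ + _)%N; rewrite addnA addnC.
(* The count of all eigenvalues, taken at [tau = 1] because the lists do not depend on [tau]; it
   determines the size of [sa]. *)
have sizes : (size sa + M + N + size sd = (r + k) * d)%N.
  have [_ <-] := det_mxrev (nzAt 1 (Some 0) (oner_neq0 _)).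
  rewrite (mupAt 1 None (oner_neq0 _)) !count_cat ca cb cc cd /=.
  have [c nzc ->] := detAt 1 (Some 0) (oner_neq0 _).
  rewrite size_scale // ppE qqE !size_mul ?mulf_neq0 //.
  rewrite (mupNroot npN) (mupNroot nqN) sza szd szp szq /=.
  have g0 : (0 < size (gg (Some 0%R)))%N by rewrite size_poly_gt0 nzg.
  have b0 : (0 < size (bb (Some 0%R)))%N by rewrite size_poly_gt0 nzb.
  exact: degrees.
exists sa, sb, sc, sd; split.
  by rewrite !size_cat szb szc -sizes !addnA.
move=> tau tau0; have nzt := lt0r_neq0 tau0.
change (fun l => A l + tau *: (U *m B l *m W)) with (At tau).
have tauU z t : \det (mxeval (YY z) t *m (tau *: U)) = tau ^+ k * (qq z).[t].
  by rewrite -scalemxAr detZ evq.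
have right_small z x : ~~ root (qq z) (ext_pt z) -> ~~ root (bb z) (ext_pt z) ->
    right_eigvec d (At tau) z x -> W *m x = 0.
  move=> nq nb [_]; rewrite mxeval_ext_perturb; apply: (perturbed_ker_small (spz z)).
    by rewrite tauU mulf_neq0 // expf_neq0.
  by rewrite evb.
have right_large z x : ~~ root (pp z) (ext_pt z) -> ~~ root (gg z) (ext_pt z) ->
    right_eigvec d (At tau) z x -> W *m x != 0.
  move=> np ng [nzx]; rewrite mxeval_ext_perturb.
  by apply: (perturbed_ker_large (spz z)); rewrite // evp.
have left_mul (y : 'cV_(r + k)) : ctr U *m y = ctr (ctr y *m U) by rewrite ctr_mul ctrK.
have left_small z y : ~~ root (pp z) (ext_pt z) -> ~~ root (bb z) (ext_pt z) ->
    left_eigvec d (At tau) z y -> ctr U *m y = 0.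
  move=> np nb [_]; rewrite mxeval_ext_perturb => yP; apply/eqP.
  rewrite left_mul ctr_eq0 -[_ == 0]orFb -(negbTE nzt) -scaler_eq0.
  by rewrite scalemxAr; apply/eqP; apply: (perturbed_coker_small (spz z)) yP; rewrite ?evp ?evb.
have left_large z y : ~~ root (qq z) (ext_pt z) -> ~~ root (gg z) (ext_pt z) ->
    left_eigvec d (At tau) z y -> ctr U *m y != 0.
  move=> nq ng [nzy]; rewrite mxeval_ext_perturb => yP; rewrite left_mul ctr_eq0.
  have : ctr y *m (tau *: U) != 0.
    apply: (perturbed_coker_large (spz z)) yP => //; last by rewrite ctr_eq0.
    by rewrite tauU mulf_neq0 // expf_neq0.
  by rewrite -scalemxAr scaler_eq0 negb_or => /andP[].
have rootAt z : root (\det (ext_mxpol d (At tau) z)) (ext_pt z) =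
    [|| z \in sa, z \in sc, z \in sd | z \in sb].
  have [c nzc ->] := detAt tau z nzt.
  by rewrite rootZ // !rootM ma mb mc md -!orbA.
have eigAt z : [|| z \in sa, z \in sc, z \in sd | z \in sb] -> peigenvalue d (At tau) z.
  by rewrite -rootAt => /(fin_eigenvalue_regular _ (nzAt tau z nzt)).
have algAt z : alg_mult d (At tau) z (count_mem z (sa ++ sb ++ sc ++ sd)).
  by rewrite -(mupAt tau z nzt); apply: fin_alg_mult_regular (nzAt tau z nzt).
have disj_ad z : z \in sa -> z \notin sd by rewrite ma md => /disjAB.
have bc_ad z : (z \in sb) || (z \in sc) -> (z \notin sa) /\ (z \notin sd).
  move=> bc; apply/andP; rewrite -negb_or -mem_cat; apply/negP => ad.
  have [|np nq] := good1 z; first by rewrite inE ad orbT.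
  by move: bc; rewrite mb mc (negbTE np) (negbTE nq).
have a_bc z : (z \in sa) || (z \in sd) -> (z \notin sb) /\ (z \notin sc).
  rewrite -mem_cat => ad; have [|np nq] := good1 z; first by rewrite inE ad orbT.
  by rewrite mb mc.
have sb_sc z : z \in sb -> z \notin sc.
  rewrite mb mc -!dvdp_XsubCl !XsubC_dvd // => b1; rewrite -leqNgt.
  by have := leq_trans (leq_add b1 (leqnn _)) (simple z).
have uniq_le1 (s : seq (option R[i])) : (forall z, (count_mem z s <= 1)%N) -> uniq s.
  move=> le1; apply: count_mem_uniq => z; have := le1 z.
  rewrite -has_pred1 has_count; by case: (count_mem z s) => [|[]].
have usb : uniq sb.
  by apply: uniq_le1 => z; rewrite cb (leq_trans (leq_addr _ _) (simple z)).
have usc : uniq sc.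
  by apply: uniq_le1 => z; rewrite cc (leq_trans (leq_addl _ _) (simple z)).
have simple_alg z : z \in sb ++ sc -> alg_mult d (At tau) z 1.
  rewrite mem_cat => bc; have [na nd] := bc_ad z bc; have := algAt z.
  rewrite !count_cat (count_memPn na) (count_memPn nd) addn0 add0n !count_uniq_mem //.
  by case: (boolP (z \in sb)) bc => [/sb_sc/negbTE->|_ /= ->].
have not_eigB z : z \notin sd -> ~ peigenvalue d B z by move=> nd /eigB; rewrite -md (negbTE nd).
split; first exact: (nzAt tau (Some 0) nzt).
split; first exact: algAt.
split; [|split; [|split]].
- split; first by move=> z; rewrite ma; symmetry; apply: eigA.
  split.
    by have := sizes; rewrite szd' mulnDl => /addIn <-; rewrite -subnDA -addnA addnK.
  move=> z za; have nd := disj_ad z za; have [|nb nc] := a_bc z; first by rewrite za.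
  rewrite md in nd; rewrite mb in nb; rewrite mc in nc.
  split; first by apply: eigAt; rewrite za.
  by split=> v; [apply: right_small|apply: left_small].
- do 2!split=> //; move=> z zb; have nc := sb_sc z zb.
  have [|na nd] := bc_ad z; first by rewrite zb.
  split; first by apply: simple_alg; rewrite mem_cat zb.
  split=> //; split; first exact: not_eigB.
  rewrite md in nd; rewrite ma in na; rewrite mc in nc.
  by split=> v; [apply: right_small|apply: left_large].
- do 2!split=> //; move=> z zc; have nb : z \notin sb by apply/negP => /sb_sc; rewrite zc.
  have [|na nd] := bc_ad z; first by rewrite zc orbT.
  split; first by apply: simple_alg; rewrite mem_cat zc orbT.
  do 2!split=> //; split; first exact: not_eigB.
  rewrite md in nd; rewrite ma in na; rewrite mb in nb.
  by split=> v; [apply: right_large|apply: left_small].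
split; first by move=> z; rewrite md; symmetry; apply: eigB.
split=> // z zd; have [|nb nc] := a_bc z; first by rewrite zd orbT.
have na : z \notin sa by apply/negP => /disj_ad; rewrite zd.
rewrite mb in nb; rewrite mc in nc; rewrite ma in na.
split; first by apply: eigAt; rewrite zd !orbT.
by split=> v; [apply: right_large|apply: left_large].
Qed.
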